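(* Let $\nu=(\nu_1>\cdots>\nu_{2m}>0)$ be a strict partition of even length $2m\le n$. Then $$GQ_\nu(x_1,\dots,x_n|\mathbf b)=\mathrm{Pf}\Big(\sum_{k=0}^\infty\sum_{l=0}^\infty\binom{i+1-2m}{k}\binom{j-2m}{l}\beta^{k+l}\,GQ^{(\nu_i,\nu_j)}_{(\nu_i+k,\nu_j+l)}(x_1,\dots,x_n|\mathbf b)\Big)_{1\le i<j\le 2m}.$$
   Context: Multiplicative formal group law: $x\oplus y:=x+y+\beta xy$, $\bar x:=-x/(1+\beta x)$, $x\ominus y:=x\oplus\bar y=(x-y)/(1+\beta y)$, $\beta$ a formal parameter. $x_1,\dots,x_n$ and $\mathbf b=(b_1,b_2,\dots)$ are indeterminates. $K$-theoretic factorial $Q$-functions: for strict $\nu$ of length $r\le n$, $GQ_\nu(x_1,\dots,x_n|\mathbf b):=\sum_{\bar w\in S_n/(S_1)^r\times S_{n-r}}w\cdot\Big[\prod_{i=1}^r(x_i\oplus x_i)\prod_{k=1}^{\nu_i-1}(x_i\oplus b_k)\prod_{i=1}^r\prod_{j=i+1}^n\frac{x_i\oplus x_j}{x_i\ominus x_j}\Big]$ ($S_n$ permutes only the $x$'s; sum over coset representatives). For an integer $q\ge0$ let $G^{(q)}(u):=\frac1{1+\beta u}\prod_{j=1}^n\frac{u\oplus x_j}{u\ominus x_j}\prod_{k=1}^{q}\frac{u\oplus b_k}{u}$. For integers $p,q\ge1$ and $k,l\ge1$ define $GQ^{(p,q)}_{(k,l)}(x_1,\dots,x_n|\mathbf b):=[u_1^{-k}u_2^{-l}]\Big(G^{(p-1)}(u_1)\,G^{(q-1)}(u_2)\,\frac{u_2\ominus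 u_1}{u_2\oplus u_1}\Big)$, where $[m](\cdot)$ denotes the coefficient of the monomial $m$, the expression is expanded in powers of the $x_j,b_k$ (denominators $u\ominus x_j$ in powers of $x_j$) and $1/(u_2\oplus u_1)$ is expanded in powers of $u_1$ with coefficients Laurent in $u_2$. $\binom{N}{k}:=N(N-1)\cdots(N-k+1)/k!$ for any integer $N$. $\mathrm{Pf}(a_{ij})_{1\le i<j\le2m}$ is the Pfaffian of the skew-symmetric $2m\times 2m$ matrix with upper entries $a_{ij}$. *)

(* Defs.v *)
From HB Require Import structures.
From mathcomp Require Import all_boot all_order all_algebra all_fingroup.
From Stdlib Require Import ClassicalEpsilon.
Set Implicit Arguments. Unset Strict Implicit. Unset Printing Implicit Defensive.
Import Order.TTheory GRing.Theory Num.Theory.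
Local Open Scope ring_scope.

(* Variables (0-based indices into 'I_(nvars n K)):                          *)
(*   x_{i+1} ~ index i  (i < n),  beta ~ index n,  b_k ~ index n+k (1<=k<=K), *)
(*   u1 ~ index n+K+1,  u2 ~ index n+K+2.                                    *)
(* A series is an arbitrary function from integer exponent vectors to int;   *)
(* products are convolutions, defined as (convergent) infinite sums: an      *)
(* infinite sum is the sum over its (finite) support when the support is     *)
(* finite (the formal/"coefficientwise" topology), and 0 otherwise.          *)
(* Formal power series in x, beta, b are the series supported on exponent    *)
(* vectors that are >= 0 in these coordinates and 0 in the u-coordinates.    *)

Definition zsum (I : countType) (f : I -> int) : int :=
  match excluded_middle_informative
          (exists s : seq I, forall i, f i != 0 -> i \in s) with
  | left H => \sum_(i <- undup (proj1_sig (constructive_indefinite_description _ H))) f i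
  | right _ => 0
  end.

Section Series.
Variables n K : nat.

Definition nvars := (n + K + 2).+1.
Definition expo := {ffun 'I_nvars -> int}.
Definition ser := expo -> int.

Definition e0 : expo := [ffun _ => 0].
Definition unit_exp (j : nat) (z : int) : expo :=
  [ffun i : 'I_nvars => if val i == j then z else 0].
Definition exp_add (e f : expo) : expo := [ffun i => e i + f i].
Definition exp_sub (e f : expo) : expo := [ffun i => e i - f i].

Definition summable (I : countType) (F : I -> ser) : Prop :=
  forall e : expo, exists s : seq I, forall i, F i e != 0 -> i \in s.

Definition fsum (I : countType) (F : I -> ser) : ser := fun e => zsum (fun i => F i e).

Definition sc (c : int) : ser := fun e => if e == e0 then c else 0.
Definition mono (j : nat) (z : int) : ser := fun e => if e == unit_exp j z then 1 else 0.
Definition sadd (f g : ser) : ser := fun e => f e + g e.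
Definition sopp (f : ser) : ser := fun e => - f e.
Definition ssub (f g : ser) : ser := sadd f (sopp g).
Definition smul (f g : ser) : ser :=
  fun e => zsum (fun e1 : expo => f e1 * g (exp_sub e e1)).
Definition spow (f : ser) (k : nat) : ser := iter k (smul f) (sc 1).

(* (1 + f)^{-1} expanded as the geometric series sum_a (-f)^a *)
Definition sinv1 (f : ser) : ser := fsum (fun a : nat => spow (sopp f) a).

Definition X (i : nat) : ser := mono i 1.           (* x_{i+1} *)
Definition Beta : ser := mono n 1.
Definition Bv (k : nat) : ser := mono (n + k) 1.    (* b_k, 1 <= k <= K *)
Definition iU1 := (n + K + 1)%N.
Definition iU2 := (n + K + 2)%N.
Definition U1 : ser := mono iU1 1.
Definition U1inv : ser := mono iU1 (-1).
Definition U2 : ser := mono iU2 1.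
Definition U2inv : ser := mono iU2 (-1).

(* multiplicative formal group law *)
Definition oplus (x y : ser) : ser := sadd (sadd x y) (smul Beta (smul x y)).
Definition sbar (x : ser) : ser := sopp (smul x (sinv1 (smul Beta x))).
Definition ominus (x y : ser) : ser := oplus x (sbar y).

(* inverse of Y expanded around the monomial u (u^{-1} = Uinv):
   Y^{-1} = u^{-1} (1 + (u^{-1} Y - 1))^{-1}, geometric series *)
Definition invU (Uinv Y : ser) : ser := smul Uinv (sinv1 (ssub (smul Uinv Y) (sc 1))).

Definition Gq (q : nat) (U Uinv : ser) : ser :=
  smul (smul (sinv1 (smul Beta U))
    (\big[smul/sc 1]_(j < n) smul (oplus U (X j)) (invU Uinv (ominus U (X j)))))
    (\big[smul/sc 1]_(1 <= k < q.+1) smul (oplus U (Bv k)) Uinv).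

Definition coef2 (k l : nat) (F : ser) : ser := fun e =>
  if (e (inord iU1) == 0) && (e (inord iU2) == 0) then
    F (exp_add e (exp_add (unit_exp iU1 (- k%:Z)) (unit_exp iU2 (- l%:Z))))
  else 0.

Definition GQpq (p q k l : nat) : ser :=
  coef2 k l (smul (smul (Gq p.-1 U1 U1inv) (Gq q.-1 U2 U2inv))
                  (smul (ominus U2 U1) (invU U2inv (oplus U2 U1)))).

(* GQ_nu(x_1..x_n|b) for a strict partition nu (as a seq, nu_1 first) of
   length r <= n.  Coset representatives of S_n/(S_1)^r x S_{n-r}: the
   permutations increasing on {r+1..n}.  Acting by w substitutes x_i -> x_{w(i)}.
   The summand for w is N_w / D_w; GQ_is nu P means P equals the sum of these
   fractions, i.e. P * prod_w D_w = sum_w N_w * prod_{w' <> w} D_{w'}. *)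
Definition coset_rep (r : nat) (s : 'S_n) : bool :=
  [forall i : 'I_n, forall j : 'I_n, ((r <= i)%N && (i < j)%N) ==> (s i < s j)%N].

Definition GQnum (nu : seq nat) (s : 'S_n) : ser :=
  \big[smul/sc 1]_(i < n | (i < size nu)%N)
    smul (smul (oplus (X (s i)) (X (s i)))
               (\big[smul/sc 1]_(1 <= k < nth 0%N nu i) oplus (X (s i)) (Bv k)))
         (\big[smul/sc 1]_(j < n | (i < j)%N) oplus (X (s i)) (X (s j))).

Definition GQden (nu : seq nat) (s : 'S_n) : ser :=
  \big[smul/sc 1]_(i < n | (i < size nu)%N)
    \big[smul/sc 1]_(j < n | (i < j)%N) ominus (X (s i)) (X (s j)).

Definition GQ_is (nu : seq nat) (P : ser) : Prop :=
  smul P (\big[smul/sc 1]_(s : 'S_n | coset_rep (size nu) s) GQden nu s) =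
  \big[sadd/sc 0]_(s : 'S_n | coset_rep (size nu) s)
     smul (GQnum nu s)
          (\big[smul/sc 1]_(s' : 'S_n | coset_rep (size nu) s' && (s' != s)) GQden nu s').

End Series.

Definition binz (N : int) (k : nat) : int :=
  ((\prod_(t < k) (N - t%:Z)) %/ (k`!)%:Z)%Z.

(* Pfaffian of the 2m x 2m skew-symmetric matrix with upper entries A i j
   (1 <= i < j <= 2m, 1-based):  sum over perfect matchings, i.e. over the
   permutations s with s(1)<s(2), s(3)<s(4), ..., s(1)<s(3)<..., of
   sgn(s) * prod_i A (s(2i-1)) (s(2i)). *)
Definition sv (N : nat) (s : 'S_N) (k : nat) : nat :=
  if insub k is Some o then val (s o) else 0%N.

Definition pf_perm (m : nat) (s : 'S_(m.*2)) : bool :=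
  [forall i : 'I_m, (sv s i.*2 < sv s i.*2.+1)%N] &&
  [forall i : 'I_m, (i.+1 < m)%N ==> (sv s i.*2 < sv s i.+1.*2)%N].

Definition Pf (n K m : nat) (A : nat -> nat -> ser n K) : ser n K :=
  \big[@sadd n K/@sc n K 0]_(s : 'S_(m.*2) | pf_perm s)
     smul (@sc n K ((-1) ^+ odd_perm s))
          (\big[@smul n K/@sc n K 1]_(i < m) A (sv s i.*2).+1 (sv s i.*2.+1).+1).

Definition pf_family (n K m : nat) (nu : seq nat) (i j : nat) : nat * nat -> ser n K :=
  fun kl => smul (@sc n K (binz (i%:Z + 1 - (m.*2)%:Z) kl.1 * binz (j%:Z - (m.*2)%:Z) kl.2))
                 (smul (spow (@Beta n K) (kl.1 + kl.2))
                       (@GQpq n K (nth 0%N nu i.-1) (nth 0%N nu j.-1)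
                             (nth 0%N nu i.-1 + kl.1) (nth 0%N nu j.-1 + kl.2))).

Definition pf_entry (n K m : nat) (nu : seq nat) (i j : nat) : ser n K :=
  fsum (@pf_family n K m nu i j).

(* Main.v *)
Require Import Defs.
From HB Require Import structures.
From mathcomp Require Import all_boot all_order all_algebra all_fingroup.
From mathcomp Require Import boolp.
From mathcomp Require Import ring zify.
From Stdlib Require Import ClassicalEpsilon.
Set Implicit Arguments. Unset Strict Implicit. Unset Printing Implicit Defensive.
Import Order.TTheory GRing.Theory Num.Theory.
Local Open Scope ring_scope.

(* Write K(u1,u2) = (u2 (-) u1)/(u2 (+) u1).  The binomial sums in the (i,j)-entry absorb
   the factors (1 + beta u1)^(i+1-2m) (1 + beta u2)^(j-2m) into the coefficient extraction,
   so the entry is the coefficient of u1^-p u2^-q (p = nu_i, q = nu_j) in a product of Laurent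
   series, i.e. an iterated residue.  The first residue, in u1, only sees the simple poles
   u1 = x_a; after it the zero of u2 (+) x_a in K(x_a,u2) is cancelled by a factor of
   G(u2), so the second residue only sees the poles u2 = x_b.  Hence the entry equals
     sum_(a,b) T_i(a) T_j(b) S(a,b),   S(a,b) = (x_b - x_a)/(x_a (+) x_b).
   The Pfaffian of T S T^t is the sum over maps f from the rows to {1..n} of
   prod_i T_i(f i) times Pf (S (f i) (f j)), and the latter is prod_(i<j) S (f i) (f j) by
   Schur's Pfaffian, because t = x/(2 + beta x) turns S into (t' - t)/(t' + t).  Maps that
   are not injective contribute 0, the injective ones are the coset representatives.

   To make sense of all expansions at once, the computation takes place in a domain of
   series whose supports are bounded below for enough linear functionals of the exponent;
   it contains the inverses of all the denominators. *)

(** * Pfaffians *)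

(** The unequal shifts [i+1-2m] and [j-2m] are what gives the matrix the shape T S T^t. Since u2 (-)
    u1 = (u2 - u1)/(1 + beta u1), the kernel supplies the first variable with the one power of 1/(1
    + beta u1) that its binomial lacks, so index i contributes the same T_i, with exponent 2m-i, as
    a row and as a column. The number 2m-i counts the j with i < j <= 2m. In the product of the
    T_i(f i) such a pair contributes (x_i (+) x_j)/(x_i (-) x_j) and also the same quotient with i
    and j exchanged; S(f i, f j) turns the unwanted quotient into 1 + beta x_i, and the power of
    1/(1 + beta x_i) in T_i removes these factors. The T_i(a) involve 1/(x_a - x_j) for both orders
    of a and j, so no ring of power series in the x's contains them. An auxiliary order of the x's
    fixes an expansion; as [GQ_is] is cleared of denominators, this choice leaves no trace in the
    result. Coefficients are integers, hence 2 is not invertible: Schur's Pfaffian is applied in the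
    fraction field of the domain of series. *)

Lemma big_inj_on (R : nmodType) (I J : finType) (h : I -> J) (P : pred J)
    (Q : pred I) (F : J -> R) : {in Q &, injective h} ->
    (forall i, Q i -> P (h i)) -> (forall j, P j -> exists2 i, Q i & j = h i) ->
  \sum_(j | P j) F j = \sum_(i | Q i) F (h i).
Proof.
move=> injh QP PQ.
have E : [set j | P j] = h @: [set i | Q i].
  apply/setP => j; rewrite inE; apply/idP/imsetP.
    by move=> /PQ[i Qi ->]; exists i; rewrite ?inE.
  by case=> i; rewrite inE => Qi ->; apply: QP.
rewrite (eq_bigl (mem [set j | P j])); last by move=> j /=; rewrite inE.
rewrite E big_imset /=; last by move=> x y; rewrite !inE; apply: injh.
by apply: eq_bigl => i; rewrite inE.
Qed.

Lemma svE (N : nat) (s : 'S_N) (o : 'I_N) : sv s o = s o.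
Proof. by rewrite /sv valK. Qed.

Lemma lift_perm_surj n (i j : 'I_n.+1) (s : 'S_n.+1) :
  s i = j -> exists s', s = lift_perm i j s'.
Proof.
move=> sij.
have neq k : j != s (lift i k) by rewrite -sij (inj_eq perm_inj) neq_lift.
pose f k := odflt k (unlift j (s (lift i k))).
have fE k : s (lift i k) = lift j (f k).
  by rewrite /f; case: unliftP (neq k) => [k' -> //|->]; rewrite eqxx.
have injf : injective f.
  move=> k k' e; apply: (@lift_inj _ i); apply: (@perm_inj _ s).
  by rewrite !fE e.
exists (perm injf); apply/permP => k; case: (unliftP i k) => [k'|] ->.
  by rewrite lift_perm_lift permE fE.
by rewrite lift_perm_id.
Qed.

Section Pfaffian.
Variable R : comNzRingType.

Definition pfaff m (A : nat -> nat -> R) : R :=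
  \sum_(s : 'S_(m.*2) | pf_perm s)
    (-1) ^+ odd_perm s * \prod_(i < m) A (sv s i.*2) (sv s i.*2.+1).

(** A matching of 2m+2 points pairs 0 with some k+1 and matches the other 2m points: [ks.1] is k,
    and [ks.2] is the matching of the rest, relabelled by skipping 0 and k+1. *)
Definition pf_lift m (ks : 'I_(m.*2.+1) * 'S_(m.*2)) : 'S_(m.+1.*2) :=
  lift_perm ord0 ord0 (lift_perm ord0 ks.1 ks.2).

Lemma pf_lift_inj m : injective (@pf_lift m).
Proof.
move=> [k s] [k' s'] /permP e.
have e1 l : lift_perm ord0 k s l = lift_perm ord0 k' s' l.
  by have := e (lift ord0 l); rewrite /pf_lift !lift_perm_lift => /lift_inj.
have ek : k = k' by have := e1 ord0; rewrite !lift_perm_id.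
rewrite -ek in e1 *; congr (_, _); apply/permP => l.
by have := e1 (lift ord0 l); rewrite !lift_perm_lift => /lift_inj.
Qed.

Lemma sv_pf_lift0 m (ks : 'I_(m.*2.+1) * 'S_(m.*2)) : sv (pf_lift ks) 0 = 0%N.
Proof. by rewrite (svE _ (ord0 : 'I_m.+1.*2)) lift_perm_id. Qed.

Lemma sv_pf_lift1 m (ks : 'I_(m.*2.+1) * 'S_(m.*2)) :
  sv (pf_lift ks) 1 = (ks.1).+1.
Proof.
by rewrite (svE _ (lift ord0 ord0 : 'I_m.+1.*2)) lift_perm_lift lift_perm_id.
Qed.

Lemma sv_pf_lift2 m (ks : 'I_(m.*2.+1) * 'S_(m.*2)) (i : nat) : (i < m.*2)%N ->
  sv (pf_lift ks) i.+2 = (bump ks.1 (sv ks.2 i)).+1.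
Proof.
move=> hi; have -> : i.+2 = lift ord0 (lift ord0 (Ordinal hi)) by [].
rewrite (svE _ (lift ord0 (lift ord0 (Ordinal hi)) : 'I_m.+1.*2)).
by rewrite !lift_perm_lift (svE _ (Ordinal hi)).
Qed.

Lemma pf_permP m (s : 'S_(m.*2)) :
  reflect ((forall i, i < m -> sv s i.*2 < sv s i.*2.+1)%N /\
           (forall i, i.+1 < m -> sv s i.*2 < sv s i.+1.*2)%N) (pf_perm s).
Proof.
apply: (iffP andP) => [[/forallP h1 /forallP h2]|[h1 h2]]; split.
- by move=> i hi; exact: (h1 (Ordinal hi)).
- by move=> i hi; move: (h2 (Ordinal (ltnW hi))) => /=; rewrite hi.
- by apply/forallP => i; apply: h1.
- by apply/forallP => i; apply/implyP => /h2.
Qed.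

(** Relabelling by [bump] preserves order, and the conditions on the first pair hold automatically
    because that pair starts with 0. *)
Lemma pf_perm_lift m (ks : 'I_(m.*2.+1) * 'S_(m.*2)) :
  pf_perm (pf_lift ks) = pf_perm ks.2.
Proof.
have lt_bump i j : (bump ks.1 i < bump ks.1 j)%N = (i < j)%N.
  by rewrite !ltnNge leq_bump2.
apply/pf_permP/pf_permP => -[h1 h2]; split.
- move=> i hi; have := h1 i.+1 hi.
  by rewrite (doubleS i) !sv_pf_lift2 ?ltnS ?lt_bump ?ltn_double ?ltn_Sdouble.
- move=> i hi; have := h2 i.+1 hi.
  by rewrite (doubleS i.+1) (doubleS i) !sv_pf_lift2 ?ltnS ?lt_bump // -?(doubleS i) ?ltn_double // ltnW.
- case=> [|i] hi; first by rewrite sv_pf_lift0 sv_pf_lift1.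
  by rewrite (doubleS i) !sv_pf_lift2 ?ltnS ?lt_bump ?ltn_double ?ltn_Sdouble ?h1.
- case=> [|i] hi; first by rewrite sv_pf_lift0 (doubleS 0) sv_pf_lift2 // double_gt0.
  by rewrite (doubleS i.+1) (doubleS i) !sv_pf_lift2 ?ltnS ?lt_bump -?(doubleS i) ?ltn_double ?h2 // ltnW.
Qed.

(** The first elements of the pairs increase and each is below its partner, so the first of all is
    the minimum 0; stripping off two values with [lift_perm_surj] then removes the first pair. *)
Lemma pf_perm_surj m (s : 'S_(m.+1.*2)) : pf_perm s -> exists ks, s = pf_lift ks.
Proof.
move=> /pf_permP[h1 h2].
have hs i : (i.+1 < m.+1)%N -> (sv s 0 < sv s i.+1.*2)%N.
  elim: i => [|i IH] hi; first exact: (h2 0%N).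
  by apply: ltn_trans (IH (ltnW hi)) (h2 _ hi).
have hs' i : (i < m.+1)%N -> (sv s 0 <= sv s i.*2)%N.
  by case: i => [|i] // /hs/ltnW.
have smin (j : 'I_m.+1.*2) : (s ord0 <= s j)%N.
  have hj : (j./2 < m.+1)%N by rewrite ltn_half_double.
  have := odd_double_half j; rewrite -(svE s ord0) -(svE s j) /=.
  case: odd => <-; rewrite ?add0n ?add1n /=; last exact: hs'.
  by rewrite ltnW //; apply: leq_ltn_trans (hs' _ hj) (h1 _ hj).
have s0 : s ord0 = ord0.
  have := smin ((s^-1)%g ord0); rewrite permKV /= leqn0 => /eqP e.
  exact: val_inj.
have [s1 ->] := lift_perm_surj s0.
have [s2 ->] := @lift_perm_surj _ ord0 (s1 ord0) s1 erefl.
by exists (s1 ord0, s2).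
Qed.

(** Expansion along the first row; the sign is the parity that [lift_perm] adds when position 1 is
    sent to k+1. *)
Lemma pfaffS m A : pfaff m.+1 A =
  \sum_(k < m.*2.+1) (-1) ^+ k * A 0%N k.+1 *
     pfaff m (fun i j => A (bump k i).+1 (bump k j).+1).
Proof.
rewrite /pfaff (big_inj_on (h := @pf_lift m) (Q := fun ks => pf_perm ks.2));
  last first.
- by move=> s hs; have [ks e] := pf_perm_surj hs; exists ks; rewrite -?pf_perm_lift -?e.
- by move=> ks; rewrite pf_perm_lift.
- by move=> x y _ _ /pf_lift_inj.
rewrite -(pair_big_dep xpredT (fun _ s => pf_perm s) (fun k s =>
  (-1) ^+ odd_perm (pf_lift (k, s)) *
  \prod_(i < m.+1) A (sv (pf_lift (k, s)) i.*2) (sv (pf_lift (k, s)) i.*2.+1))) /=.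
apply: eq_bigr => k _; rewrite mulr_sumr; apply: eq_bigr => s _.
rewrite big_ord_recl /= sv_pf_lift0 sv_pf_lift1 /=.
have -> : odd_perm (pf_lift (k, s)) = odd k (+) odd_perm s.
  by rewrite /pf_lift !odd_lift_perm.
rewrite signr_addb signr_odd !mulrA (mulrAC _ _ (A _ _)); congr (_ * _).
apply: eq_bigr => i _; rewrite /bump leq0n add1n (doubleS i).
by rewrite !sv_pf_lift2 ?ltn_double ?ltn_Sdouble.
Qed.

Lemma pfaff0 A : pfaff 0 A = 1.
Proof.
rewrite /pfaff (bigD1 1%g) /=; last by apply/pf_permP; split.
rewrite [X in _ + X]big1 => [|s /andP[_ /negP[]]]; last by apply/eqP/permP => -[].
by rewrite big_ord0 odd_perm1 mulr1 addr0.
Qed.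

Lemma eq_pfaff m (A B : nat -> nat -> R) :
  (forall i j, (i < j)%N -> (j < m.*2)%N -> A i j = B i j) ->
  pfaff m A = pfaff m B.
Proof.
move=> AB; apply: eq_bigr => s /pf_permP[h1 _]; congr (_ * _).
apply: eq_bigr => i _; apply: AB; first exact: h1.
have hi : (i.*2.+1 < m.*2)%N by rewrite ltn_Sdouble.
by rewrite (svE s (Ordinal hi)).
Qed.

Lemma prod_double m (F : nat -> R) :
  \prod_(i < m.*2) F i = \prod_(i < m) (F i.*2 * F i.*2.+1).
Proof.
elim: m => [|m IH]; first by rewrite !big_ord0.
by rewrite doubleS 2!big_ord_recr /= IH big_ord_recr /= mulrA.
Qed.

Lemma ltn_dord m (i : 'I_m) (b : bool) : (b + i.*2 < m.*2)%N.
Proof. by case: b; rewrite ?add1n ?add0n ?ltn_Sdouble ?ltn_double. Qed.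

Definition dord m (i : 'I_m) (b : bool) : 'I_(m.*2) := Ordinal (ltn_dord i b).

Lemma distr_pairs m (I : finType) (G : 'I_m -> I -> I -> R) :
  \prod_(i < m) (\sum_a \sum_b G i a b) =
  \sum_(f : {ffun 'I_(m.*2) -> I})
     \prod_(i < m) G i (f (dord i false)) (f (dord i true)).
Proof.
under eq_bigr do rewrite pair_big /=.
rewrite bigA_distr_bigA /=.
pose h (f : {ffun 'I_(m.*2) -> I}) : {ffun 'I_m -> I * I} :=
  [ffun i => (f (dord i false), f (dord i true))].
have half_lt (k : 'I_(m.*2)) : (k./2 < m)%N by rewrite ltn_half_double.
pose g (p : {ffun 'I_m -> I * I}) : {ffun 'I_(m.*2) -> I} :=
  [ffun k : 'I_(m.*2) => let ab := p (Ordinal (half_lt k)) in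
      if odd k then ab.2 else ab.1].
rewrite (reindex h) /=.
  by apply: eq_bigr => f _; apply: eq_bigr => i _; rewrite ffunE.
exists g => [f _|p _].
  apply/ffunP => k; rewrite !ffunE /=.
  have := odd_double_half k.
  by case: (odd k) => e; congr (f _); apply: val_inj; rewrite /= e.
apply/ffunP => i; rewrite !ffunE /= odd_double /=.
have -> : Ordinal (half_lt (dord i false)) = i by apply: val_inj; exact: doubleK.
have -> : Ordinal (half_lt (dord i true)) = i.
  by apply: val_inj; exact: uphalf_double.
by case: (p i).
Qed.

(** Matrices of [pfaff] are indexed by [nat], so a map on ['I_N] has to be continued; [a0] is a
    dummy value. *)
Definition ext (I : Type) N (a0 : I) (f : 'I_N -> I) (k : nat) : I :=
  if insub k is Some o then f o else a0.

Lemma extE (I : Type) N (a0 : I) (f : 'I_N -> I) (o : 'I_N) : ext a0 f o = f o.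
Proof. by rewrite /ext valK. Qed.

Lemma prod_dord m (F : 'I_(m.*2) -> R) :
  \prod_k F k = \prod_(i < m) (F (dord i false) * F (dord i true)).
Proof.
rewrite (eq_bigr (fun k : 'I_(m.*2) => ext 1 F k)); last by move=> k _; rewrite extE.
rewrite prod_double; apply: eq_bigr => i _.
by rewrite -(extE 1 F (dord i false)) -(extE 1 F (dord i true)).
Qed.

(** Distributing the product of one matching over the double sums gives one summation index per row.
    A matching only permutes the rows, so after reindexing f by [s] the product of the T's no longer
    depends on [s], and exchanging the sums leaves one Pfaffian for each f. *)
Lemma pfaff_congruence m (I : finType) (a0 : I) (T : nat -> I -> R)
    (S : I -> I -> R) :
  pfaff m (fun i j => \sum_a \sum_b T i a * T j b * S a b) =
  \sum_(f : {ffun 'I_(m.*2) -> I}) (\prod_(k < m.*2) T k (f k)) *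
    pfaff m (fun i j => S (ext a0 f i) (ext a0 f j)).
Proof.
under [RHS]eq_bigr do rewrite mulr_sumr.
rewrite exchange_big /=; apply: eq_bigr => s _.
under [RHS]eq_bigr do rewrite mulrCA.
rewrite -mulr_sumr; congr (_ * _).
rewrite distr_pairs.
pose h (f : {ffun 'I_(m.*2) -> I}) : {ffun 'I_(m.*2) -> I} := [ffun k => f (s k)].
pose g (f : {ffun 'I_(m.*2) -> I}) : {ffun 'I_(m.*2) -> I} :=
  [ffun k => f ((s^-1)%g k)].
rewrite (reindex h) /=; last first.
  by exists g => f _; apply/ffunP => k; rewrite !ffunE ?permKV ?permK.
apply: eq_bigr => f _; rewrite big_split /=; congr (_ * _).
  rewrite [RHS](reindex_inj (@perm_inj _ s)) /= prod_dord.
  by apply: eq_bigr => i _; rewrite !ffunE -!svE.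
apply: eq_bigr => i _; rewrite !ffunE -!(extE a0 f).
by rewrite -!svE.
Qed.

End Pfaffian.

(** * Schur's Pfaffian *)

Section Schur.
Variable F : fieldType.
Implicit Types (y : nat -> F) (z : F).

Definition schur_ratio (a b : F) : F := (b - a) / (b + a).
Local Notation sg := schur_ratio.

Definition schur_prod N y : F := \prod_(i < N) \prod_(j < N | (i < j)%N) sg (y i) (y j).

Lemma schur_ratioN a b : sg a b = - sg b a.
Proof. by rewrite /sg -mulNr opprB (addrC a). Qed.

Lemma schur_ratioxx a : sg a a = 0.
Proof. by rewrite /sg subrr mul0r. Qed.

Lemma prod_sign N k :
  \prod_(j < N) (if (k <= j)%N then -1 else 1) = (-1) ^+ (N - k) :> F.
Proof.
elim: N => [|N IH]; first by rewrite big_ord0.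
rewrite big_ord_recr /= IH; case: leqP => h.
  by rewrite subSn // exprSr.
have -> : (N - k = 0)%N by lia.
have -> : (N.+1 - k = 0)%N by lia.
by rewrite mulr1.
Qed.

(** The factors involving index k are isolated and all written with [y k] on the right; [N - k] of
    them are turned round by antisymmetry, which gives the sign. *)
Lemma schur_prod_bump N y (k : 'I_N.+1) : schur_prod N.+1 y =
  (-1) ^+ (N - k) * (\prod_(j < N) sg (y (bump k j)) (y k)) *
  schur_prod N (y \o bump k).
Proof.
rewrite /schur_prod (bigD1_ord k) //= big_mkcond (bigD1_ord k) //= ltnn mul1r.
under [X in _ * X]eq_bigr => i _.
  rewrite big_mkcond (bigD1_ord k) //=.
  over.
rewrite big_split mulrA; congr (_ * _).
  rewrite -prod_sign -!big_split; apply: eq_bigr => j _ /=.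
  have -> : (k < bump k j)%N = (k <= j)%N by rewrite /bump; lia.
  have -> : (bump k j < k)%N = ~~ (k <= j)%N by rewrite /bump; lia.
  by case: leqP => _ /=; rewrite ?mulr1 ?mul1r // mulN1r schur_ratioN.
apply: eq_bigr => i _; rewrite [RHS]big_mkcond /=; apply: eq_bigr => j _.
by rewrite !ltnNge leq_bump2.
Qed.

(* Lagrange interpolation at the points [- y k], and evaluation at 0 to get
   rid of the constant term. *)
Lemma schur_partial_fractions N y z : odd N ->
  (forall i j : 'I_N, i != j -> y i != y j) ->
  (forall i j : 'I_N, y i + y j != 0) -> (forall i : 'I_N, y i + z != 0) ->
  \prod_(j < N) sg z (y j) =
  \sum_(k < N) sg z (y k) * \prod_(j < N | j != k) ((y k + y j) / (y k - y j)).
Proof.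
move=> oddN ydiff ysum yz.
pose c (k : 'I_N) := \prod_(j < N | j != k) ((y k + y j) / (y k - y j)).
pose M (k : 'I_N) : {poly F} := \prod_(j < N | j != k) ('X + (y j)%:P).
pose q : {poly F} := \prod_(j < N) ('X - (y j)%:P) - \prod_(j < N) ('X + (y j)%:P)
   + \sum_(k < N) (2%:R * c k * y k) *: M k.
have prodXE : \prod_(j < N) ('X + (y j)%:P) = \prod_(j < N) ('X - (- y j)%:P).
  by apply: eq_bigr => j _; rewrite polyCN opprK.
have hprod (s : F) : (\prod_(j < N) ('X + (y j)%:P)).[s] = \prod_(j < N) (s + y j).
  by rewrite horner_prod; apply: eq_bigr => j _; rewrite hornerD hornerX hornerC.
have hprodB (s : F) : (\prod_(j < N) ('X - (y j)%:P)).[s] = \prod_(j < N) (s - y j).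
  by rewrite horner_prod; apply: eq_bigr => j _; rewrite hornerD hornerN hornerX hornerC.
have hM k (s : F) : (M k).[s] = \prod_(j < N | j != k) (s + y j).
  by rewrite horner_prod; apply: eq_bigr => j _; rewrite hornerD hornerX hornerC.
have signN (P : pred 'I_N) (f : 'I_N -> F) : \prod_(j | P j) (- f j) =
    (-1) ^+ #|P| * \prod_(j | P j) f j by rewrite prodrN.
have cardk (k : 'I_N) : #|[pred j | j != k]| = N.-1.
  by rewrite cardC1 card_ord.
have evN1 : ~~ odd N.-1 by case: N oddN {y ydiff ysum yz c M q prodXE hprod hprodB hM signN cardk}.
(* The two monic products lose their leading terms, so q has degree below N; the coefficients
   [2 * c k * y k] are chosen to make the N distinct points [- y k] roots. The parity of N enters
   through the sign (-1)^(N-1) = 1. *)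
have q0 : q = 0.
  apply: (@roots_geq_poly_eq0 _ _ [seq - y k | k : 'I_N]).
  - apply/allP => _ /mapP[k _ ->]; rewrite rootE /q 2!hornerD hornerN hprodB hprod horner_sum.
    have -> : \prod_(j < N) (- y k + y j) = 0 by rewrite (bigD1 k) //= addNr mul0r.
    rewrite [X in _ + X](bigD1 k) // [X in _ + (_ + X)]big1 => [|l nlk]; last first.
      by rewrite hornerZ hM (bigD1 k) 1?eq_sym //= addNr mul0r mulr0.
    rewrite hornerZ hM addr0 subr0 (bigD1 k) //=.
    have -> : \prod_(j < N | j != k) (- y k - y j) = \prod_(j < N | j != k) (y k + y j).
      under eq_bigr do rewrite -opprD.
      by rewrite signN cardk -signr_odd (negbTE evN1) expr0 mul1r.
    have e : c k * \prod_(j < N | j != k) (- y k + y j) = \prod_(j < N | j != k) (y k + y j).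
      rewrite /c -big_split /=.
      under eq_bigr => j njk.
        have -> : (y k + y j) / (y k - y j) * (- y k + y j) = - (y k + y j).
          rewrite -[- y k + y j]opprK opprD opprK mulrN divfK //.
          by rewrite subr_eq0 ydiff // eq_sym.
        over.
      by rewrite signN cardk -signr_odd (negbTE evN1) expr0 mul1r.
    have -> : 2%:R * c k * y k * \prod_(j < N | j != k) (- y k + y j) =
      2 * y k * (c k * \prod_(j < N | j != k) (- y k + y j)) by ring.
    by apply/eqP; rewrite e; ring.
  - rewrite map_inj_uniq ?enum_uniq // => i j /oppr_inj e.
    by apply/eqP; apply: contraT => /ydiff; rewrite e eqxx.
  rewrite size_map size_enum_ord /q.
  have szs (f : 'I_N -> F) (P : pred 'I_N) :
      size (\prod_(j < N | P j) ('X - (f j)%:P)) = #|P|.+1.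
    rewrite -big_filter size_prod_XsubC -sum1_size big_filter.
    by rewrite sum1dep_card cardsE.
  apply: leq_trans (size_polyD _ _) _; rewrite geq_max; apply/andP; split.
    apply/leq_sizeP => j; rewrite leq_eqVlt coefB prodXE => /predU1P[<-|Nj].
      have lc (f : 'I_N -> F) : (\prod_(j < N) ('X - (f j)%:P))`_N = 1.
        rewrite -(lead_coef_prod_XsubC (index_enum _) xpredT f) lead_coefE.
        by rewrite (szs f xpredT) cardT size_enum_ord.
      by rewrite !lc subrr.
    by rewrite !nth_default ?subrr // (szs _ xpredT) cardT size_enum_ord.
  apply: leq_trans (size_sum _ _ _) _; apply/bigmax_leqP => k _.
  apply: leq_trans (size_scale_leq _ _) _.
  have -> : M k = \prod_(j < N | j != k) ('X - (- y j)%:P).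
    by apply: eq_bigr => j _; rewrite polyCN opprK.
  by rewrite szs cardk prednK // (leq_ltn_trans _ (ltn_ord k)).
have evq s : \prod_(j < N) (s - y j) = \prod_(j < N) (s + y j)
    - 2 * \sum_(k < N) c k * y k * \prod_(j < N | j != k) (s + y j).
  have := congr1 (horner^~ s) q0; rewrite /q horner0 2!hornerD hornerN hprodB hprod horner_sum.
  under [X in _ + X]eq_bigr do rewrite hornerZ hM -(mulrA 2) -(mulrA 2).
  rewrite -mulr_sumr => e; apply/eqP; rewrite -subr_eq0 -[X in _ == X]e; apply/eqP.
  by ring.
have k0 : 'I_N by exists 0%N; case: (N) oddN.
have nz2 : 2 != 0 :> F.
  apply: contraNneq (ysum k0 k0) => e2.
  by rewrite -mulr2n -mulr_natl e2 mul0r.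
have ynz (k : 'I_N) : y k != 0.
  by apply: contraNneq (ysum k k) => ->; rewrite addr0.
(* At 0 every term is a multiple of the product P of the [y j], and N odd gives -P = P - 2 (sum of
   the c k) P. Both 2 and P can be cancelled because [y i + y i != 0]. *)
have csum : \sum_k c k = 1.
  have Pk (k : 'I_N) : y k * \prod_(j < N | j != k) (0 + y j) = \prod_(j < N) y j.
    by rewrite [RHS](bigD1 k) //=; under eq_bigr do rewrite add0r.
  have := evq 0.
  under eq_bigr do rewrite sub0r.
  under [X in X - _]eq_bigr do rewrite add0r.
  rewrite signN cardT size_enum_ord -signr_odd oddN expr1 mulN1r.
  under [X in 2 * X]eq_bigr => k _.
    rewrite -mulrA Pk; over.
  rewrite -mulr_suml; set P := \prod_(j < N) y j; set C := \sum_i _.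
  have Pnz : P != 0 by apply/prodf_neq0.
  move=> e; apply: (mulIf Pnz); apply: (mulfI nz2).
  apply/eqP; rewrite mul1r -subr_eq0.
  have -> : 2 * (C * P) - 2 * P = - (P - 2 * (C * P) - - P) by ring.
  by rewrite -e subrr oppr0.
have zy (k : 'I_N) : z + y k != 0 by rewrite addrC.
pose D := \prod_(j < N) (z + y j).
have Dnz : D != 0 by apply/prodf_neq0.
have -> : \prod_(j < N) sg z (y j) = - (\prod_(j < N) (z - y j) / D).
  rewrite /D prodf_div; under eq_bigr do rewrite -opprB.
  rewrite signN cardT size_enum_ord -signr_odd oddN expr1 mulN1r mulNr.
  by under [X in _ = - (_ / X)]eq_bigr do rewrite addrC.
rewrite (evq z) mulrBl divff // -/D.
under [RHS]eq_bigr => k _.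
  have -> : sg z (y k) = - 1 + 2 * (y k / (z + y k)).
    by rewrite /sg (addrC _ z); field.
  rewrite -/(c k) mulrDl mulN1r; over.
rewrite big_split /= sumrN csum opprB addrC; congr (_ + _).
rewrite mulr_sumr mulr_suml; apply: eq_bigr => k _.
rewrite /D [X in _ / X](bigD1 k) //=.
have nz : \prod_(j < N | j != k) (z + y j) != 0 by apply/prodf_neq0.
by field; rewrite nz zy.
Qed.

Lemma eq_schur_prod N y y' : (forall i, (i < N)%N -> y i = y' i) ->
  schur_prod N y = schur_prod N y'.
Proof.
by move=> e; apply: eq_bigr => i _; apply: eq_bigr => j _; rewrite !e.
Qed.

Lemma schur_prod_eq0 N y p q : (p < q < N)%N -> y p = y q -> schur_prod N y = 0.
Proof.
case/andP=> pq qN e.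
rewrite /schur_prod (bigD1 (Ordinal (ltn_trans pq qN))) //=.
by rewrite (bigD1 (Ordinal qN)) //= e schur_ratioxx !mul0r.
Qed.

(* Removing either of two equal entries leaves the same values, in an order
   that differs by a cycle of length [q - p]. *)
Lemma schur_prod_bump_eq N y p q : (p < q <= N)%N -> y p = y q ->
  (-1) ^+ p * schur_prod N (y \o bump p) + (-1) ^+ q * schur_prod N (y \o bump q) = 0.
Proof.
case: N => [|N]; first by rewrite leqn0 => /andP[+ /eqP q0]; rewrite q0.
move=> /andP[pq qN] e.
have hq : (q.-1 < N.+1)%N by lia.
have hp : (p < N.+1)%N by lia.
rewrite (@schur_prod_bump _ (y \o bump p) (Ordinal hq)).
rewrite (@schur_prod_bump _ (y \o bump q) (Ordinal hp)) /=.
have eb j : bump p (bump q.-1 j) = bump q (bump p j) by rewrite /bump; lia.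
have e1 : y (bump p q.-1) = y q by congr y; rewrite /bump; lia.
have e2 : y (bump q p) = y q by rewrite -e; congr y; rewrite /bump; lia.
rewrite e1 e2.
rewrite (@eq_schur_prod _ ((y \o bump p) \o bump q.-1) ((y \o bump q) \o bump p)); last first.
  by move=> i _ /=; rewrite eb.
under eq_bigr do rewrite eb.
rewrite !mulrA -!exprD -!mulrDl.
have -> : (q + (N - p) = (p + (N - q.-1)).+1 + ((q - p.+1).*2))%N by lia.
rewrite -[(-1) ^+ (_.+1 + _)]signr_odd oddD odd_double addbF signr_odd exprS.
by rewrite mulN1r subrr !mul0r.
Qed.

(** The inductive step of Schur's Pfaffian, with z as the first variable. For distinct y's, division
    by [schur_prod] turns it into the partial fraction identity. Coincidences must be covered too,
    since the Pfaffian is later taken along maps that are not injective; there both sides vanish. *)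
Lemma schur_expand m y z :
  (forall i j, y i + y j != 0) -> (forall i, y i + z != 0) ->
  \sum_(k < m.*2.+1) (-1) ^+ k * sg z (y k) * schur_prod m.*2 (y \o bump k) =
  \prod_(j < m.*2.+1) sg z (y j) * schur_prod m.*2.+1 y.
Proof.
move=> ysum yz.
case: (boolP [exists p : 'I_m.*2.+1, exists q : 'I_m.*2.+1, (p < q)%N && (y p == y q)]).
  case/existsP=> p /existsP[q /andP[pq /eqP e]].
  have pq' : (p < q < m.*2.+1)%N by rewrite pq ltn_ord.
  rewrite (schur_prod_eq0 pq' e) mulr0 (bigD1 p) // (bigD1 q) /=; last first.
    by apply: contraTneq pq => ->; rewrite ltnn.
  (* Any k other than p and q leaves both equal entries in place, so its term is 0; the terms of p
     and q cancel each other. *)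
  rewrite big1 ?addr0 => [|k /andP[kp kq]].
    rewrite -e !(mulrAC _ (sg _ _)) -mulrDl.
    by rewrite (schur_prod_bump_eq _ e) ?mul0r // pq -ltnS ltn_ord.
  have ltqM : (q < m.*2.+1)%N by [].
  have ltkM : (k < m.*2.+1)%N by [].
  have neqp : (p != k :> nat)%N by rewrite eq_sym.
  have neqq : (q != k :> nat)%N by rewrite eq_sym.
  rewrite (@schur_prod_eq0 _ _ (unbump k p) (unbump k q)) ?mulr0 //.
    by rewrite /unbump; lia.
  by rewrite /= !unbumpKcond (negbTE neqp) (negbTE neqq) !add0n.
move=> /existsPn ninj.
have ydiff (i j : 'I_m.*2.+1) : i != j -> y i != y j.
  move=> nij; apply/eqP => e; move: nij; rewrite -val_eqE neq_ltn => /orP[] lt.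
    by move: (ninj i) => /existsPn/(_ j); rewrite lt e eqxx.
  by move: (ninj j) => /existsPn/(_ i); rewrite lt e eqxx.
rewrite (@schur_partial_fractions _ y z) //= ?odd_double //.
rewrite mulr_suml; apply: eq_bigr => k _.
rewrite -mulrA mulrCA -mulrA; congr (_ * _).
rewrite (schur_prod_bump y k) !mulrA; congr (_ * _).
have -> : \prod_(j < m.*2) sg (y (bump k j)) (y k) =
    \prod_(j < m.*2.+1 | j != k) sg (y j) (y k).
  rewrite [RHS]big_mkcond [RHS](bigD1_ord k) //= eqxx mul1r; apply: eq_bigr => j _.
  by rewrite eq_sym neq_lift.
rewrite mulrAC -big_split /= big1 => [|j njk]; last first.
  by rewrite /sg mulrA divfK ?divff // subr_eq0 ydiff // eq_sym.
rewrite mul1r -signr_odd -[in RHS]signr_odd oddB; last by rewrite -ltnS.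
by rewrite odd_double.
Qed.

Theorem schur_pfaffian m y : (forall i j, y i + y j != 0) ->
  pfaff m (fun i j => sg (y i) (y j)) = schur_prod m.*2 y.
Proof.
elim: m y => [|m IH] y ysum; first by rewrite pfaff0 /schur_prod big_ord0.
rewrite pfaffS.
under eq_bigr => k _ do rewrite (IH (fun i => y (bump k i).+1)) //.
rewrite (@schur_expand m (fun i => y i.+1) (y 0%N)) //.
rewrite doubleS /schur_prod [RHS]big_ord_recl /=; congr (_ * _).
  by rewrite [RHS]big_mkcond [RHS]big_ord_recl /= mul1r.
apply: eq_bigr => i _; rewrite [RHS]big_mkcond [RHS]big_ord_recl /= mul1r.
by rewrite big_mkcond.
Qed.

End Schur.

(** * Coset representatives and partial fractions *)

Lemma coset_repP n r (s : 'S_n) :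
  reflect (forall i j : 'I_n, (r <= i)%N -> (i < j)%N -> (s i < s j)%N) (coset_rep r s).
Proof.
apply: (iffP forallP) => [h i j ri ij|h i].
  by have /forallP/(_ j) := h i; rewrite ri ij.
by apply/forallP => j; apply/implyP => /andP[]; apply: h.
Qed.

(** Strong induction on the position k. Beyond r, if one value at k were smaller, the other
    permutation would take it either earlier, where both agree, or later, against monotonicity. *)
Lemma coset_rep_inj n r (s s' : 'S_n) : coset_rep r s -> coset_rep r s' ->
  (forall i : 'I_n, (i < r)%N -> s i = s' i) -> s = s'.
Proof.
move=> /coset_repP hs /coset_repP hs' e.
suff key i : forall k : 'I_n, val k = i -> s k = s' k by apply/permP => k; exact: (key k).
elim/ltn_ind: i => i IH k ki.
case: (ltnP k r) => [/e //|rk].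
have lt_contra (t t' : 'S_n) :
    (forall i j : 'I_n, (r <= i)%N -> (i < j)%N -> (t' i < t' j)%N) ->
    (forall l : 'I_n, (l < k)%N -> t l = t' l) -> ~~ (t k < t' k)%N.
  move=> ht' eq_lt; apply/negP => lt.
  pose l := (t'^-1)%g (t k).
  have tl : t' l = t k by rewrite /l permKV.
  case: (ltngtP l k) => [llk|kll|/val_inj elk].
  - by move: (eq_lt _ llk); rewrite tl => /perm_inj elk; rewrite elk ltnn in llk.
  - by have := ht' k l rk kll; rewrite tl ltnNge ltnW.
  - by move: lt; rewrite -tl elk ltnn.
apply/val_inj/eqP; rewrite eqn_leq leqNgt [X in _ && X]leqNgt.
rewrite !lt_contra // => l; rewrite ki => /IH -/(_ l erefl) //.
Qed.

Lemma coset_rep_surj n r (rn : (r <= n)%N) (f : {ffun 'I_r -> 'I_n}) : injectiveb f ->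
  exists2 s : 'S_n, coset_rep r s & f = [ffun i => s (widen_ord rn i)].
Proof.
move=> /injectiveP injf.
case: n rn f injf => [|n] rn f injf.
  exists 1%g; first by apply/coset_repP => -[].
  by apply/ffunP => i; case: (f i).
pose l := codom f ++ [seq k <- enum 'I_n.+1 | k \notin codom f].
have ul : uniq l.
  rewrite cat_uniq map_inj_uniq ?enum_uniq // filter_uniq ?enum_uniq //= andbT.
  by apply/hasPn => k; rewrite mem_filter => /andP[].
have sl : size l = n.+1.
  rewrite -(card_uniqP ul) -[RHS]card_ord; apply: eq_card => k.
  by rewrite mem_cat mem_filter mem_enum andbT inE orbN.
have injs : injective (fun i : 'I_n.+1 => nth ord0 l i).
  by move=> i j /eqP; rewrite nth_uniq ?sl // => /eqP/val_inj.
have sc : size (codom f) = r by rewrite size_codom card_ord.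
exists (perm injs).
  apply/coset_repP => i j ri ij; rewrite !permE !nth_cat sc.
  have -> : (i < r)%N = false by rewrite ltnNge ri.
  have -> : (j < r)%N = false by rewrite ltnNge (leq_trans ri (ltnW ij)).
  set w := [seq k <- _ | _].
  have sw : sorted (fun a b : 'I_n.+1 => (a < b)%N) w.
    apply: sorted_filter; first by move=> a b c; apply: ltn_trans.
    by have := iota_ltn_sorted 0 n.+1; rewrite -val_enum_ord sorted_map.
  have szw : (size w = n.+1 - r)%N by rewrite -(addKn r (size w)); congr (_ - _)%N; rewrite -sc -size_cat.
  apply: (sorted_ltn_nth (leT := fun a b : 'I_n.+1 => (a < b)%N)) => //.
  - by move=> a b c; apply: ltn_trans.
  - by rewrite inE szw; have := ltn_ord i; lia.
  - by rewrite inE szw; have := ltn_ord j; lia.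
  - by lia.
apply/ffunP => i; rewrite !ffunE permE nth_cat sc /= ltn_ord /codom /image_mem.
by rewrite (nth_map i) ?size_enum_ord // nth_ord_enum.
Qed.

Lemma sum_coset_rep (R : nmodType) n r (rn : (r <= n)%N) (G : {ffun 'I_r -> 'I_n} -> R) :
  \sum_(f : {ffun 'I_r -> 'I_n} | injectiveb f) G f =
  \sum_(s : 'S_n | coset_rep r s) G [ffun i => s (widen_ord rn i)].
Proof.
apply: big_inj_on => [s s' hs hs' e|s _|f]; last exact: coset_rep_surj.
  apply: coset_rep_inj hs hs' _ => i ir.
  have := congr1 (fun g : {ffun 'I_r -> 'I_n} => g (Ordinal ir)) e.
  by rewrite !ffunE; congr (s _ = s' _); apply: val_inj.
apply/injectiveP => i j; rewrite !ffunE => /perm_inj e.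
by apply: val_inj; exact: (congr1 val e).
Qed.

(** Lagrange interpolation of the constant 1 at the points [x a], divided by the product of all
    [u - x j]. *)
Lemma partial_fractions (F : fieldType) N (x : 'I_N -> F) (u : F) : (0 < N)%N ->
  injective x -> (forall j, u != x j) ->
  (\prod_j (u - x j))^-1 =
  \sum_a (u - x a)^-1 * \prod_(j | j != a) (x a - x j)^-1.
Proof.
move=> N0 injx ux.
pose L (a : 'I_N) : {poly F} := \prod_(j | j != a) ('X - (x j)%:P).
pose c (a : 'I_N) := \prod_(j | j != a) (x a - x j)^-1.
have LE (a : 'I_N) s : (L a).[s] = \prod_(j | j != a) (s - x j).
  by rewrite horner_prod; apply: eq_bigr => j _; rewrite hornerXsubC.
pose q : {poly F} := \sum_a c a *: L a - 1.
have q0 : q = 0.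
  apply: (@roots_geq_poly_eq0 _ _ [seq x k | k : 'I_N]).
  - apply/allP => _ /mapP[k _ ->]; rewrite rootE /q hornerD hornerN hornerC horner_sum.
    rewrite (bigD1 k) //= big1 ?addr0 => [|l nlk]; last first.
      by rewrite hornerZ LE (bigD1 k) 1?eq_sym //= subrr mul0r mulr0.
    rewrite hornerZ LE -big_split big1 ?subrr //= => j njk.
    by rewrite mulVf // subr_eq0 (inj_eq injx) eq_sym.
  - by rewrite map_inj_uniq ?enum_uniq.
  rewrite size_map size_enum_ord /q.
  apply: leq_trans (size_polyD _ _) _; rewrite geq_max size_polyN size_poly1 N0 andbT.
  apply: leq_trans (size_sum _ _ _) _; apply/bigmax_leqP => k _.
  apply: leq_trans (size_scale_leq _ _) _.
  rewrite /L -big_filter size_prod_XsubC -sum1_size big_filter sum1dep_card cardsE.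
  by rewrite cardC1 card_ord prednK.
have e : \sum_a c a * \prod_(j | j != a) (u - x j) = 1.
  have := congr1 (horner^~ u) q0; rewrite horner0 /q hornerD hornerN hornerC horner_sum.
  move/eqP; rewrite subr_eq0 => /eqP e; rewrite -[RHS]e; apply: eq_bigr => a _.
  by rewrite hornerZ LE.
rewrite -[LHS]mulr1 -[X in _ * X = _]e mulr_sumr; apply: eq_bigr => a _.
rewrite [in LHS](bigD1 a) //= -/(c a).
have nz : \prod_(j | j != a) (u - x j) != 0 by apply/prodf_neq0 => j _; rewrite subr_eq0.
by field; rewrite nz subr_eq0 ux.
Qed.

(** * The domain of series *)

Section Zsum.
Implicit Types I J : countType.

Definition finsupp I (f : I -> int) := exists s : seq I, forall i, f i != 0 -> i \in s.

Lemma big_supp I (f : I -> int) (s t : seq I) : uniq s -> uniq t ->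
  (forall i, f i != 0 -> i \in s) -> (forall i, f i != 0 -> i \in t) ->
  \sum_(i <- s) f i = \sum_(i <- t) f i.
Proof.
move=> us ut hs ht.
have E r : \sum_(i <- r) f i = \sum_(i <- [seq j <- r | f j != 0]) f i.
  by rewrite big_filter [RHS]big_mkcond; apply: eq_bigr => i _; case: eqVneq.
rewrite (E s) (E t); apply: perm_big; apply: uniq_perm; rewrite ?filter_uniq // => i.
by rewrite !mem_filter; case: eqVneq => //= h; rewrite (hs i h) (ht i h).
Qed.

Lemma zsumE I (f : I -> int) (s : seq I) : uniq s ->
  (forall i, f i != 0 -> i \in s) -> zsum f = \sum_(i <- s) f i.
Proof.
move=> us hs; rewrite /zsum; case: excluded_middle_informative => [H|[]]; last by exists s.
case: constructive_indefinite_description => /= t ht.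
by apply: big_supp; rewrite ?undup_uniq // => i /ht; rewrite mem_undup.
Qed.

Lemma finsuppP I (f : I -> int) : finsupp f ->
  exists2 s : seq I, uniq s & forall i, f i != 0 -> i \in s.
Proof.
by case=> s hs; exists (undup s) => [|i /hs]; rewrite ?undup_uniq ?mem_undup.
Qed.

Lemma eq_zsum I (f g : I -> int) : f =1 g -> zsum f = zsum g.
Proof. by move=> /funext ->. Qed.

Lemma zsum_neq0 I (f : I -> int) : zsum f != 0 -> exists i, f i != 0.
Proof.
move=> h; apply: contrapT => nex.
have f0 i : f i = 0 by apply/eqP; apply: contraT => fi; case: nex; exists i.
by move: h; rewrite (@zsumE _ f [::]) ?big_nil ?eqxx // => i; rewrite f0 eqxx.
Qed.

Lemma zsum_single I (f : I -> int) i0 : (forall i, i != i0 -> f i = 0) -> zsum f = f i0.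
Proof.
move=> h; rewrite (@zsumE _ f [:: i0]) ?big_seq1 // => i; rewrite inE.
by apply: contraR => /h ->.
Qed.

Lemma zsumD I (f g : I -> int) : finsupp f -> finsupp g ->
  zsum (fun i => f i + g i) = zsum f + zsum g.
Proof.
move=> [s hs] [t ht]; pose r := undup (s ++ t).
have ur : uniq r by rewrite undup_uniq.
have hf i : f i != 0 -> i \in r by move=> /hs; rewrite mem_undup mem_cat => ->.
have hg i : g i != 0 -> i \in r by move=> /ht; rewrite mem_undup mem_cat orbC => ->.
rewrite (zsumE ur hf) (zsumE ur hg) -big_split; apply: zsumE => // i.
by case: (eqVneq (f i) 0) => [->|/hf //]; rewrite add0r; apply: hg.
Qed.

Lemma zsumMl I (f : I -> int) c : finsupp f -> zsum (fun i => c * f i) = c * zsum f.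
Proof.
move=> /finsuppP[s us hs]; rewrite (zsumE us hs) mulr_sumr; apply: zsumE => // i.
by rewrite mulf_eq0 negb_or => /andP[_ /hs].
Qed.

Lemma zsum_reindex I J (h : J -> I) (f : I -> int) : injective h ->
  (forall i, f i != 0 -> exists j, i = h j) -> finsupp (f \o h) ->
  zsum f = zsum (f \o h).
Proof.
move=> injh hf /finsuppP[t ut ht].
rewrite (zsumE ut ht) (@zsumE _ f [seq h j | j <- t]) ?big_map ?map_inj_uniq // => i fi.
by case: (hf i fi) => j e; rewrite e map_f // ht //= -e.
Qed.

Lemma zsum_pair I J (f : I * J -> int) : finsupp f ->
  zsum f = zsum (fun i => zsum (fun j => f (i, j))).
Proof.
case=> s hs.
pose si := undup [seq p.1 | p <- s]; pose sj := undup [seq p.2 | p <- s].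
have usi : uniq si by rewrite undup_uniq.
have usj : uniq sj by rewrite undup_uniq.
have hij i j : f (i, j) != 0 -> (i \in si) && (j \in sj).
  by move=> /hs h; rewrite !mem_undup (map_f fst h) (map_f snd h).
have e i : zsum (fun j => f (i, j)) = \sum_(j <- sj) f (i, j).
  by apply: zsumE => // j /hij/andP[].
rewrite (@zsumE _ f [seq (i, j) | i <- si, j <- sj]); last first.
- by move=> [i j] /hij/andP[hi hj]; apply/allpairsP; exists (i, j).
- by apply: allpairs_uniq => // -[i j] [i' j'] _ _.
rewrite big_allpairs (@zsumE _ _ si) //; first by apply: eq_bigr => i _.
by move=> i /zsum_neq0[j /hij/andP[]].
Qed.

End Zsum.

(** * The ring of series and its integrality *)

Section SeriesRing.
Variables n K : nat.
Local Notation expo := (expo n K).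
Local Notation ser := (ser n K).
Local Notation nvars := (nvars n K).
Implicit Types (e : expo) (v w : 'I_nvars) (f g : ser).

Lemma exp_subE (e e' : expo) : exp_sub e e' = e - e'.
Proof. by apply/ffunP => i; rewrite !ffunE. Qed.

Lemma e0E : e0 n K = 0.
Proof. by apply/ffunP => i; rewrite !ffunE. Qed.

(* Position of a variable in the chain [beta, u2, u1, x_1, ..., x_n, b_1, ..., b_K].
   For two variables v, w other than beta with v before w, the series ring below
   contains the expansions in powers of w / v and of beta v. *)
Definition vpos v : nat :=
  if val v == n then 0%N else if val v == iU2 n K then 1%N
  else if val v == iU1 n K then 2%N else if (v < n)%N then v.+3 else v.+2.

Lemma vpos_eq0 v : (vpos v == 0)%N = (val v == n).
Proof. by rewrite /vpos; do 4!case: ifP => //. Qed.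

Lemma vpos_inj : injective vpos.
Proof.
move=> v w e; apply: val_inj; move: e (ltn_ord v) (ltn_ord w).
rewrite /vpos /iU1 /iU2 /nvars /=; move: (nat_of_ord v) (nat_of_ord w) => i j.
by repeat (case: ifP => ?); lia.
Qed.

Lemma vpos_lt v : (vpos v < nvars)%N.
Proof.
have := ltn_ord v; rewrite /vpos /iU1 /iU2 /nvars /=; move: (nat_of_ord v) => i.
by repeat (case: ifP => ?); lia.
Qed.

(** [L t] is the exponent of beta minus the exponents of the variables at positions 1 to t. It is
    nonnegative on beta v, and on w/v when v comes before w, so lower bounds on all [L t] select
    exactly the kind of expansion wanted. Beyond the last position [L t] no longer changes with
    t. *)
Definition Lcoef (t : nat) v : int :=
  if val v == n then 1 else if (vpos v <= t)%N then -1 else 0.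

Definition L (t : nat) e : int := \sum_v Lcoef t v * e v.

Lemma LD t e e' : L t (e + e') = L t e + L t e'.
Proof. by rewrite -big_split; apply: eq_bigr => v _; rewrite ffunE mulrDr. Qed.

Lemma LN t e : L t (- e) = - L t e.
Proof. by rewrite -sumrN; apply: eq_bigr => v _; rewrite ffunE mulrN. Qed.

Lemma LB t e e' : L t (e - e') = L t e - L t e'.
Proof. by rewrite LD LN. Qed.

Lemma L0 t : L t 0 = 0.
Proof. by rewrite /L big1 // => v _; rewrite ffunE mulr0. Qed.

Lemma coordE e v :
  e v = if val v == n then L 0 e else L (vpos v).-1 e - L (vpos v) e.
Proof.
case: ifP => vn.
  rewrite /L (bigD1 v) //= /Lcoef vn mul1r big1 ?addr0 // => w nwv.
  have -> : (val w == n) = false.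
    by apply: contraNF nwv => wn; rewrite -val_eqE (eqP wn) (eqP vn).
  case: ifP; rewrite ?mul0r // leqn0 vpos_eq0 => wn; case/negP: nwv.
  by rewrite -val_eqE (eqP wn) (eqP vn).
rewrite /L -sumrB (bigD1 v) //= big1 ?addr0 => [|w nwv]; rewrite -mulrBl /Lcoef.
  have v0 : (0 < vpos v)%N by rewrite lt0n vpos_eq0 vn.
  by rewrite vn leqnn -ltnS prednK // ltnn sub0r opprK mul1r.
case: ifP => _; first by rewrite subrr mul0r.
have : (vpos w != vpos v) by rewrite (inj_eq vpos_inj).
have v0 : (0 < vpos v)%N by rewrite lt0n vpos_eq0 vn.
move=> nwv'; have -> : (vpos w <= (vpos v).-1)%N = (vpos w <= vpos v)%N by lia.
by rewrite subrr mul0r.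
Qed.

Lemma L_inj e e' : (forall t, (t < nvars)%N -> L t e = L t e') -> e = e'.
Proof.
move=> h; apply/ffunP => v; rewrite !coordE.
have vlt := vpos_lt v; case: ifP => _; rewrite !h //.
exact: leq_ltn_trans (leq_pred _) vlt.
Qed.

Lemma L_bound t e : `|L t e| <= \sum_v `|e v|.
Proof.
apply: le_trans (ler_norm_sum _ _ _) _; apply: ler_sum => v _.
rewrite normrM ler_piMl //; rewrite /Lcoef; case: ifP => _; first by rewrite normr1.
by case: ifP => _; rewrite ?normrN ?normr1 ?normr0.
Qed.

(** As [L t] is additive, the two lower bounds give [|L t e1| <= M]. Each coordinate is a value or a
    difference of these functionals, hence at most 2M in absolute value, and [dec] enumerates that
    cube. This is what makes convolutions finite sums. *)
Lemma box (N : nat) e : exists s : seq expo, forall e1,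
  (forall t, - N%:Z <= L t e1) -> (forall t, - N%:Z <= L t (e - e1)) -> e1 \in s.
Proof.
pose M := (N + absz (\sum_v `|e v|)%R)%N.
pose dec (f : {ffun 'I_nvars -> 'I_(4 * M).+1}) : expo := [ffun v => (f v)%:Z - (2 * M)%:Z].
exists [seq dec f | f : {ffun 'I_nvars -> 'I_(4 * M).+1}] => e1 h1 h2.
have LM t : `|L t e1| <= M%:Z.
  have S0 : 0 <= \sum_v `|e v| by apply: sumr_ge0.
  have := h1 t; have := h2 t; have := L_bound t e.
  rewrite LB /M PoszD gez0_abs // !ler_norml => /andP[b1 b2] b3 b4.
  by apply/andP; split; lia.
have eM v : `|e1 v| <= 2 * M%:Z.
  have := LM (vpos v); have := LM (vpos v).-1; have := LM 0%N.
  rewrite coordE !ler_norml => /andP[b1 b2] /andP[b3 b4] /andP[b5 b6].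
  by case: ifP => _; apply/andP; split; lia.
apply/mapP; exists [ffun v => inord (absz (e1 v + (2 * M)%:Z))]; first by rewrite mem_enum.
apply/ffunP => v; have := eM v; rewrite ler_norml => /andP[b1 b2].
have b3 : 0 <= e1 v + (2 * M)%:Z by lia.
rewrite !ffunE inordK; first by rewrite gez0_abs // addrK.
move: b1 b2 b3; move: (e1 v : int) => z; lia.
Qed.

Definition good f := exists N : nat, forall e, f e != 0 -> forall t, - N%:Z <= L t e.

Lemma good2 f g : good f -> good g -> exists N : nat, 
  (forall e, f e != 0 -> forall t, - N%:Z <= L t e) /\
  (forall e, g e != 0 -> forall t, - N%:Z <= L t e).
Proof.
move=> [N hN] [M hM]; exists (N + M)%N; split=> e he t.
  by have := hN e he t; lia.
by have := hM e he t; lia.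
Qed.

Lemma conv_fin f g e : good f -> good g -> finsupp (fun e1 => f e1 * g (exp_sub e e1)).
Proof.
move=> gf gg; have [N [hf hg]] := good2 gf gg.
have [s hs] := box N e; exists s => e1; rewrite exp_subE mulf_eq0 negb_or.
by move=> /andP[/hf h1 /hg h2]; apply: hs.
Qed.

Lemma good_add f g : good f -> good g -> good (sadd f g).
Proof.
move=> gf gg; have [N [hf hg]] := good2 gf gg; exists N => e.
by rewrite /sadd; case: (eqVneq (f e) 0) => [->|/hf //]; rewrite add0r; apply: hg.
Qed.

Lemma good_opp f : good f -> good (sopp f).
Proof. by move=> [N hN]; exists N => e; rewrite /sopp oppr_eq0; apply: hN. Qed.

Lemma smul_neq0 f g e : smul f g e != 0 ->
  exists e1, f e1 != 0 /\ g (e - e1) != 0.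
Proof.
move=> /zsum_neq0[e1]; rewrite exp_subE mulf_eq0 negb_or => /andP[h1 h2].
by exists e1.
Qed.

Lemma good_mul f g : good f -> good g -> good (smul f g).
Proof.
move=> [N hN] [M hM]; exists (N + M)%N => e /smul_neq0[e1 [/hN h1 /hM h2]] t.
by have := h1 t; have := h2 t; rewrite LB; lia.
Qed.

Lemma good_delta (a : expo) (c : int) : good (fun e => if e == a then c else 0).
Proof.
exists (absz (\sum_v `|a v|)) => e /=; case: (eqVneq e a) => [-> _ t|_]; last by rewrite eqxx.
have S0 : 0 <= \sum_v `|a v| by apply: sumr_ge0.
by have := L_bound t a; rewrite gez0_abs // ler_norml => /andP[].
Qed.

Lemma good_sc c : good (@sc n K c). Proof. exact: good_delta. Qed.

Lemma smulC f g : good f -> good g -> smul f g = smul g f.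
Proof.
move=> gf gg; apply/funext => e; rewrite /smul.
have subK e1 : exp_sub e (exp_sub e e1) = e1 by rewrite !exp_subE opprB addrC subrK.
rewrite (@zsum_reindex _ _ (exp_sub e)).
- by apply: eq_zsum => e1 /=; rewrite subK mulrC.
- by move=> a b /(congr1 (exp_sub e)); rewrite !subK.
- by move=> e1 _; exists (exp_sub e e1); rewrite subK.
have [s hs] := conv_fin e gg gf; exists s => e1 /=.
by rewrite subK mulrC; apply: hs.
Qed.

Lemma smulDl f g h : good f -> good g -> good h ->
  smul (sadd f g) h = sadd (smul f h) (smul g h).
Proof.
move=> gf gg gh; apply/funext => e; rewrite /smul /sadd -zsumD; try exact: conv_fin.
by apply: eq_zsum => e1; rewrite mulrDl.
Qed.

Lemma smul_delta a c f e : smul (fun e => if e == a then c else 0) f e = c * f (e - a).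
Proof.
rewrite /smul; have -> := @zsum_single _ (fun e1 => (if e1 == a then c else 0) * f (exp_sub e e1)) a.
  by rewrite eqxx exp_subE.
by move=> e1 /negbTE ->; rewrite mul0r.
Qed.

Lemma smul_sc c f e : smul (@sc n K c) f e = c * f e.
Proof. by rewrite (smul_delta _ c f) e0E subr0. Qed.

(** Both sides equal one finitely supported sum over pairs of exponents; its support is finite
    because the lower bounds on the three factors put both exponents of a pair in one [box]. *)
Lemma smulA f g h : good f -> good g -> good h ->
  smul f (smul g h) = smul (smul f g) h.
Proof.
move=> gf gg gh; apply/funext => e.
pose P (p : expo * expo) := f p.1 * (g p.2 * h (e - p.1 - p.2)).
pose Q (p : expo * expo) := f p.2 * g (p.1 - p.2) * h (e - p.1).
have finP : finsupp P.
  have [N1 [hf hg]] := good2 gf gg; have [N2 [_ hh]] := good2 gf gh.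
  pose N := (N1 + N1 + N2)%N; have [s hs] := box N e.
  exists [seq (a, b) | a <- s, b <- s] => -[a b] /=.
  rewrite !mulf_eq0 !negb_or /= => /andP[/hf ha /andP[/hg hb /hh hc]].
  apply/allpairsP; exists (a, b); split=> //=; apply: hs => t;
    have := ha t; have := hb t; have := hc t; rewrite ?LB /N; lia.
pose k (p : expo * expo) := (p.1 + p.2, p.1).
have PE : Q \o k = P.
  by apply/funext => -[a b]; rewrite /P /Q /= addrC addKr opprD addrA mulrA.
transitivity (zsum P).
  rewrite zsum_pair //; apply: eq_zsum => a; rewrite /P /= exp_subE -zsumMl.
    by apply: eq_zsum => b; rewrite exp_subE.
  exact: conv_fin.
transitivity (zsum Q).
  rewrite -PE -(@zsum_reindex _ _ k Q) //; last by rewrite PE.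
    by move=> [a b] [a' b'] [e1 e2]; move: e1; rewrite e2 => /addrI ->.
  by move=> [a b] _; exists (b, a - b); rewrite /k /= addrC subrK.
rewrite zsum_pair; last first.
  case: finP => s hs; exists [seq k p | p <- s] => -[a b] h0.
  apply/mapP; exists (b, a - b); last by rewrite /k /= addrC subrK.
  by apply: hs; rewrite -PE /k /= addrC subrK.
apply: eq_zsum => a; rewrite exp_subE mulrC -zsumMl; last exact: conv_fin.
by apply: eq_zsum => b; rewrite /Q /= exp_subE mulrC.
Qed.

Record lser := LSer { lval : ser; _ : good lval }.
Implicit Types (F G : lser).

Lemma lvalP F : good (lval F). Proof. by case: F. Qed.

Lemma lval_inj : injective lval.
Proof. by move=> [f hf] [g hg] /= e; move: hf hg; rewrite e => hf hg; congr LSer; apply: Prop_irrelevance. Qed.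

HB.instance Definition _ := gen_eqMixin lser.
HB.instance Definition _ := gen_choiceMixin lser.

Definition ladd F G := LSer (good_add (lvalP F) (lvalP G)).
Definition lopp F := LSer (good_opp (lvalP F)).
Definition lmul F G := LSer (good_mul (lvalP F) (lvalP G)).
Definition lsc c := LSer (good_sc c).

Lemma sc0E e : @sc n K 0 e = 0. Proof. by rewrite /sc; case: ifP. Qed.

Lemma laddA : associative ladd.
Proof. by move=> F G H; apply/lval_inj/funext => e; rewrite /= /sadd addrA. Qed.
Lemma laddC : commutative ladd.
Proof. by move=> F G; apply/lval_inj/funext => e; rewrite /= /sadd addrC. Qed.
Lemma ladd0 : left_id (lsc 0) ladd.
Proof. by move=> F; apply/lval_inj/funext => e; rewrite /= /sadd sc0E add0r. Qed.
Lemma laddN : left_inverse (lsc 0) lopp ladd.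
Proof. by move=> F; apply/lval_inj/funext => e; rewrite /= /sadd /sopp sc0E addNr. Qed.

HB.instance Definition _ := GRing.isZmodule.Build lser laddA laddC ladd0 laddN.

Lemma lmulA : associative lmul.
Proof. by move=> F G H; apply/lval_inj/smulA; apply: lvalP. Qed.
Lemma lmulC : commutative lmul.
Proof. by move=> F G; apply/lval_inj/smulC; apply: lvalP. Qed.
Lemma lmul1 : left_id (lsc 1) lmul.
Proof. by move=> F; apply/lval_inj/funext => e; rewrite /= smul_sc mul1r. Qed.
Lemma lmulDl : left_distributive lmul ladd.
Proof. by move=> F G H; apply/lval_inj/smulDl; apply: lvalP. Qed.
Lemma lsc1_neq0 : lsc 1 != 0.
Proof. by apply/eqP => /(congr1 (fun F => lval F (e0 n K))); rewrite /= /sc eqxx. Qed.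

HB.instance Definition _ :=
  GRing.Zmodule_isComNzRing.Build lser lmulA lmulC lmul1 lmulDl lsc1_neq0.

(** Units and inverses are obtained by classical choice; the explicit inverses come later from
    geometric series. *)
Definition lunit : pred lser := fun F => `[< exists G, G * F = 1 >].
Definition linv F : lser :=
  if pselect (exists G, G * F = 1) is left P then projT1 (cid P) else F.

Lemma lmulVr : {in lunit, left_inverse 1 linv *%R}.
Proof.
move=> F /asboolP FU; rewrite /linv; case: pselect => // P.
exact: projT2 (cid P).
Qed.
Lemma lunitP F G : G * F = 1 -> lunit F.
Proof. by move=> e; apply/asboolP; exists G. Qed.
Lemma linv_out : {in [predC lunit], linv =1 id}.
Proof. by move=> F /asboolPn nU; rewrite /linv; case: pselect. Qed.

HB.instance Definition _ :=
  GRing.ComNzRing_hasMulInverse.Build lser lmulVr lunitP linv_out.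

Lemma lval0E e : lval 0 e = 0. Proof. exact: sc0E. Qed.
Lemma lval1 : lval 1 = sc 1. Proof. by []. Qed.
Lemma lvalD F G : lval (F + G) = sadd (lval F) (lval G). Proof. by []. Qed.
Lemma lvalN F : lval (- F) = sopp (lval F). Proof. by []. Qed.
Lemma lvalM F G : lval (F * G) = smul (lval F) (lval G). Proof. by []. Qed.

Lemma lser_ext F G : (forall e, lval F e = lval G e) -> F = G.
Proof. by move=> h; apply/lval_inj/funext. Qed.

(** Induction on T: among the support exponents that agree with the current e on the earlier
    functionals, one with least [L T] exists because [L T] is bounded below on the support. *)
Lemma lexmin F T : F != 0 -> exists2 e, lval F e != 0 &
  forall e', lval F e' != 0 -> forall t, (t < T)%N ->
    (forall s, (s < t)%N -> L s e' = L s e) -> L t e <= L t e'.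
Proof.
move=> F0; elim: T => [|T [e eF IH]].
  have : exists e, lval F e != 0.
    apply: contrapT => nex; case/eqP: F0; apply/lser_ext => e.
    by rewrite lval0E; apply/eqP; apply: contraT => h; case: nex; exists e.
  by case=> e eF; exists e.
have [N hN] := lvalP F.
pose A (k : nat) := `[< exists e', [/\ lval F e' != 0,
  forall s, (s < T)%N -> L s e' = L s e & L T e' + N%:Z = k%:Z] >].
have exA : exists k, A k.
  exists (absz (L T e + N%:Z)); apply/asboolP; exists e; split=> //.
  by rewrite gez0_abs //; have := hN e eF T; lia.
case: (ex_minnP exA) => k /asboolP[e1 [e1F e1e e1k]] kmin.
exists e1 => // e' e'F t; rewrite ltnS leq_eqVlt => /predU1P[->|tT] h.
  have : A (absz (L T e' + N%:Z)).
    apply/asboolP; exists e'; split=> // [s sT|]; first by rewrite h // e1e.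
    by rewrite gez0_abs //; have := hN e' e'F T; lia.
  by move=> /kmin; have := hN e' e'F T; lia.
rewrite e1e //; apply: IH => // s st.
by rewrite h // e1e // (ltn_trans st).
Qed.

(* The sum of the lexicographic minima of two supports decomposes in only one way. *)
Lemma lser_integral F G : F * G = 0 -> (F == 0) || (G == 0).
Proof.
move=> FG0; apply: contraT; rewrite negb_or => /andP[F0 G0].
have [a aF amin] := lexmin nvars F0; have [b bG bmin] := lexmin nvars G0.
have := congr1 (fun H => lval H (a + b)) FG0; rewrite lval0E lvalM /smul => h.
suff : lval F a * lval G b = 0 by move/eqP; rewrite mulf_eq0 (negbTE aF) (negbTE bG).
rewrite -[RHS]h (@zsum_single _ _ a) ?exp_subE ?(addrC a) ?addrK // => a'.
apply: contraNeq; rewrite exp_subE mulf_eq0 negb_or => /andP[a'F b'G].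
apply/eqP/L_inj; elim/ltn_ind => t IH tT.
have IHa s : (s < t)%N -> L s a' = L s a by move=> st; rewrite IH // (ltn_trans st).
have IHb s : (s < t)%N -> L s (b + a - a') = L s b.
  by move=> st; rewrite LB LD IHa // addrK.
have := amin _ a'F _ tT IHa; have := bmin _ b'G _ tT IHb; rewrite LB LD; lia.
Qed.

HB.instance Definition _ := GRing.ComUnitRing_isIntegral.Build lser lser_integral.

End SeriesRing.

(** * Support conditions and geometric series *)

Section Supports.
Variables n K : nat.
Local Notation expo := (expo n K).
Local Notation lser := (lser n K).
Local Notation nvars := (nvars n K).
Implicit Types (e a b : expo) (v w : 'I_nvars) (F G : lser) (M : expo -> Prop).

Lemma lval_sum (I : Type) (r : seq I) (P : pred I) (F : I -> lser) e :
  lval (\sum_(i <- r | P i) F i) e = \sum_(i <- r | P i) lval (F i) e.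
Proof. by apply: (big_morph (fun G => lval G e)) => [//|]; rewrite lval0E. Qed.

Lemma lval_exp F k : lval (F ^+ k) = spow (lval F) k.
Proof. by elim: k => // k IH; rewrite exprS lvalM IH. Qed.

Definition lmon a : lser := LSer (good_delta a 1).

Lemma lval_lmon a e : lval (lmon a) e = if e == a then 1 else 0.
Proof. by []. Qed.

Lemma lval_lmonM a F e : lval (lmon a * F) e = lval F (e - a).
Proof. by rewrite lvalM smul_delta mul1r. Qed.

Lemma lmonD a b : lmon (a + b) = lmon a * lmon b.
Proof.
by apply: lser_ext => e; rewrite lval_lmonM !lval_lmon subr_eq addrC.
Qed.

Lemma lmon0 : lmon 0 = 1.
Proof. by apply: lser_ext => e; rewrite lval1 /sc e0E. Qed.

Lemma lmonMn a k : lmon (a *+ k) = lmon a ^+ k.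
Proof. by elim: k => [|k IH]; rewrite ?mulr0n ?lmon0 // mulrS exprS lmonD IH. Qed.

Lemma lmon_unit a : lmon a \is a GRing.unit.
Proof. by apply/unitrP; exists (lmon (- a)); rewrite -!lmonD subrr addNr lmon0. Qed.

Lemma lmonN a : lmon (- a) = (lmon a)^-1.
Proof. by apply: (mulIr (lmon_unit a)); rewrite mulVr ?lmon_unit // -lmonD addNr lmon0. Qed.

(** Submonoids of exponents. Series supported in one are stable under products and geometric series,
    so that a condition such as being free of a variable passes to all the inverses used below. *)
Definition addpred M := M 0 /\ forall a b, M a -> M b -> M (a + b).
Definition supp_in M F := forall e, lval F e != 0 -> M e.

Lemma supp_in0 M : supp_in M 0.
Proof. by move=> e; rewrite lval0E eqxx. Qed.

Lemma supp_inD M F G : supp_in M F -> supp_in M G -> supp_in M (F + G).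
Proof.
move=> hF hG e; rewrite lvalD /sadd.
by case: (eqVneq (lval F e) 0) => [->|/hF //]; rewrite add0r; apply: hG.
Qed.

Lemma supp_inN M F : supp_in M F -> supp_in M (- F).
Proof. by move=> hF e; rewrite lvalN /sopp oppr_eq0; apply: hF. Qed.

Lemma supp_inB M F G : supp_in M F -> supp_in M G -> supp_in M (F - G).
Proof. by move=> hF hG; apply: supp_inD (supp_inN hG). Qed.

Lemma supp_in_lmon M a : M a -> supp_in M (lmon a).
Proof.
move=> Ma e; rewrite lval_lmon; have [-> //|/negbTE ne] := eqVneq e a.
by rewrite ?ne eqxx.
Qed.

Lemma sub_supp_in M M' F : (forall e, M e -> M' e) -> supp_in M F -> supp_in M' F.
Proof. by move=> h hF e /hF/h. Qed.

Section AddPred.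
Variables (M : expo -> Prop) (addM : addpred M).

Lemma supp_in1 : supp_in M 1.
Proof. by rewrite -lmon0; apply: supp_in_lmon; case: addM. Qed.

Lemma supp_inM F G : supp_in M F -> supp_in M G -> supp_in M (F * G).
Proof.
move=> hF hG e /smul_neq0[e1 [/hF h1 /hG h2]].
by rewrite -(subrK e1 e) addrC; apply: (proj2 addM).
Qed.

Lemma supp_in_prod (I : Type) (r : seq I) (P : pred I) (F : I -> lser) :
  (forall i, P i -> supp_in M (F i)) -> supp_in M (\prod_(i <- r | P i) F i).
Proof. by move=> h; elim/big_ind: _ => //; [exact: supp_in1 | exact: supp_inM]. Qed.

Lemma supp_in_exp F k : supp_in M F -> supp_in M (F ^+ k).
Proof.
by move=> h; elim: k => [|k IH]; rewrite ?exprS; [exact: supp_in1 | exact: supp_inM].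
Qed.

End AddPred.

Definition nonnegL e := forall t, 0 <= L t e.
Definition W e : int := \sum_(t < nvars) L t e.

Lemma addpred_nonnegL : addpred nonnegL.
Proof.
split=> [t|a b ha hb t]; first by rewrite L0.
by rewrite LD addr_ge0.
Qed.

Lemma W_ge0 e : nonnegL e -> 0 <= W e.
Proof. by move=> h; apply: sumr_ge0 => t _; apply: h. Qed.

Lemma WB e e' : W (e - e') = W e - W e'.
Proof. by rewrite -sumrB; apply: eq_bigr => t _; rewrite LB. Qed.

(** Each small factor raises the weight [W] and nonnegative factors cannot lower it, so at a given
    exponent only finitely many powers of a small series contribute. *)
Definition small F := supp_in (fun e => nonnegL e /\ 0 < W e) F.

Lemma small_nonneg F : small F -> supp_in nonnegL F.
Proof. by apply: sub_supp_in => e []. Qed.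

Lemma smallM F G : small F -> supp_in nonnegL G -> small (F * G).
Proof.
move=> hF hG e /smul_neq0[e1 [/hF[h1 h1'] /hG h2]]; split.
  by rewrite -(subrK e1 e); apply: (proj2 addpred_nonnegL).
by have := W_ge0 h2; rewrite WB; lia.
Qed.

Lemma small_exp F k e : small F -> lval (F ^+ k) e != 0 -> nonnegL e /\ k%:Z <= W e.
Proof.
move=> hF; elim: k e => [|k IH] e.
  by rewrite expr0 => /(supp_in1 addpred_nonnegL) h; split=> //; apply: W_ge0.
rewrite exprS => /smul_neq0[e1 [/hF[h1 h1'] /IH[h2 h2']]]; split.
  by rewrite -(subrK e1 e); apply: (proj2 addpred_nonnegL).
by move: h2'; rewrite WB; lia.
Qed.

Lemma sinv1_sum G e B : small G -> W e < B%:Z ->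
  sinv1 (lval G) e = \sum_(a < B) lval ((- G) ^+ a) e.
Proof.
move=> hG WB; rewrite /sinv1 /fsum -(big_mkord xpredT (fun k => lval ((- G) ^+ k) e)).
rewrite /index_iota subn0; have E k : spow (sopp (lval G)) k = lval ((- G) ^+ k).
  by rewrite lval_exp.
under eq_bigr do rewrite -E.
apply: zsumE; first exact: iota_uniq.
move=> a; rewrite E mem_iota add0n => /(small_exp (supp_inN hG))[_ h].
by move: WB; lia.
Qed.

Lemma sinv1_good G : small G -> good (sinv1 (lval G)).
Proof.
move=> hG; exists 0%N => e /zsum_neq0[a]; rewrite -lvalN -lval_exp oppr0.
by move=> /(small_exp (supp_inN hG))[h _].
Qed.

(** At a fixed exponent e only powers below some B > [W e] matter. The truncated geometric sum gives
    1 up to [(- G) ^+ B], whose exponents have weight at least B and so miss e. *)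
Lemma geomE G (hG : small G) : (1 + G) * LSer (sinv1_good hG) = 1.
Proof.
apply: lser_ext => e.
pose B := (absz (W e)).+1.
have WB' : W e < B%:Z by rewrite /B; lia.
have -> : lval ((1 + G) * LSer (sinv1_good hG)) e =
    lval ((1 + G) * \sum_(a < B) (- G) ^+ a) e.
  rewrite !lvalM /smul; apply: eq_zsum => e1; rewrite exp_subE lval_sum.
  case: (eqVneq (lval (1 + G) e1) 0) => [->|h]; first by rewrite !mul0r.
  congr (_ * _); rewrite /= (@sinv1_sum _ _ B) //.
  have : nonnegL e1.
    exact: (supp_inD (supp_in1 addpred_nonnegL) (small_nonneg hG) h).
  by move/W_ge0; rewrite WB; lia.
have -> : (1 + G) * \sum_(a < B) (- G) ^+ a = 1 - (- G) ^+ B.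
  by rewrite -[RHS]opprB subrX1 -mulNr opprB opprK.
rewrite lvalD lvalN /sadd /sopp.
case: (eqVneq (lval ((- G) ^+ B) e) 0) => [->|]; first by rewrite oppr0 addr0.
by move=> /(small_exp (supp_inN hG))[_]; lia.
Qed.

Lemma small_unit G : small G -> 1 + G \is a GRing.unit.
Proof. by move=> hG; apply/unitrP; exists (LSer (sinv1_good hG)); rewrite mulrC geomE. Qed.

Lemma lval_geom G : small G -> lval (1 + G)^-1 = sinv1 (lval G).
Proof.
move=> hG; have -> : (1 + G)^-1 = LSer (sinv1_good hG); last by [].
by apply: (mulrI (small_unit hG)); rewrite geomE divrr ?small_unit.
Qed.

Lemma supp_in_geom M G : addpred M -> small G -> supp_in M G -> supp_in M (1 + G)^-1.
Proof.
move=> addM hG hM e; rewrite lval_geom // => /zsum_neq0[a].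
by rewrite -lvalN -lval_exp; apply: supp_in_exp => //; apply: supp_inN.
Qed.

End Supports.

(** * Inverses and residues *)

Section Variables.
Variables n K : nat.
Local Notation expo := (expo n K).
Local Notation lser := (lser n K).
Local Notation nvars := (nvars n K).
Implicit Types (e a b : expo) (v w : 'I_nvars) (F G : lser) (M : expo -> Prop).
Local Notation ue := (unit_exp n K).

Lemma ueE j z v : ue j z v = if val v == j then z else 0.
Proof. by rewrite ffunE. Qed.

Lemma ueN j z : ue j (- z) = - ue j z.
Proof. by apply/ffunP => v; rewrite !ffunE; case: ifP; rewrite ?oppr0. Qed.

Lemma L_ue t v z : L t (ue v z) = Lcoef t v * z.
Proof.
rewrite /L (bigD1 v) //= ueE eqxx big1 ?addr0 // => w nwv.
by rewrite ueE val_eqE (negbTE nwv) mulr0.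
Qed.

Lemma n_lt_nvars : (n < nvars)%N. Proof. by rewrite /nvars; lia. Qed.
Definition vbeta : 'I_nvars := Ordinal n_lt_nvars.

Lemma L_beta t z : L t (ue n z) = z.
Proof. by rewrite (L_ue t vbeta) /Lcoef eqxx mul1r. Qed.

Definition lbeta : lser := lmon (ue n 1).
Definition lvar v : lser := lmon (ue v 1).

Definition geo v := val v != n.

Lemma vpos_gt0 v : geo v -> (0 < vpos v)%N.
Proof. by rewrite lt0n vpos_eq0. Qed.

Lemma L_geo t v z : geo v -> L t (ue v z) = if (vpos v <= t)%N then - z else 0.
Proof.
by move=> gv; rewrite L_ue /Lcoef (negbTE gv); case: ifP; rewrite ?mulN1r ?mul0r.
Qed.

Lemma W_gt0 e t : nonnegL e -> (t < nvars)%N -> 0 < L t e -> 0 < W e.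
Proof.
move=> h tT Lt; rewrite /W (bigD1 (Ordinal tT)) //=.
by apply: ltr_wpDr => //; apply: sumr_ge0 => i _; apply: h.
Qed.

Lemma small_lmon a t : nonnegL a -> (t < nvars)%N -> 0 < L t a -> small (lmon a).
Proof. by move=> h tT Lt; apply: supp_in_lmon; split=> //; apply: W_gt0 Lt. Qed.

Lemma smallD F G : small F -> small G -> small (F + G).
Proof. exact: supp_inD. Qed.

Lemma smallN F : small F -> small (- F).
Proof. exact: supp_inN. Qed.

Lemma small_beta v : geo v -> small (lbeta * lvar v).
Proof.
move=> gv; rewrite -lmonD; apply: (@small_lmon _ 0%N) => // [t|].
  by rewrite LD L_beta L_geo //; case: ifP.
by rewrite LD L_beta L_geo // leqNgt vpos_gt0.
Qed.

Lemma lvarV v : (lvar v)^-1 = lmon (ue v (- 1)).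
Proof. by rewrite ueN lmonN. Qed.

Lemma lvar_unit v : lvar v \is a GRing.unit. Proof. exact: lmon_unit. Qed.

Lemma small_ratio v w : geo v -> geo w -> (vpos v < vpos w)%N ->
  small ((lvar v)^-1 * lvar w).
Proof.
move=> gv gw vw; rewrite lvarV -lmonD; apply: (@small_lmon _ (vpos v)); last first.
- by rewrite LD !L_geo // leqnn leqNgt vw.
- exact: vpos_lt.
- move=> t; rewrite LD !L_geo //.
  by case: ifP; case: ifP => //; lia.
Qed.

Definition opl F G := F + G + lbeta * (F * G).
Definition omn F G := opl F (- (G * (1 + lbeta * G)^-1)).

Lemma lval_opl F G : lval (opl F G) = oplus (lval F) (lval G). Proof. by []. Qed.

Lemma lval_omn F G : small (lbeta * G) -> lval (omn F G) = ominus (lval F) (lval G).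
Proof. by move=> h; rewrite lval_opl /ominus /sbar lvalN lvalM lval_geom. Qed.

Lemma omnE F G : small (lbeta * G) -> omn F G = (F - G) / (1 + lbeta * G).
Proof.
move=> /small_unit h; apply: (mulIr h); rewrite divrK // /omn /opl.
set D := 1 + _ in h *.
have e : D^-1 * D = 1 by rewrite mulVr.
transitivity (F * D - G * (D^-1 * D) - lbeta * F * G * (D^-1 * D)); first by ring.
by rewrite e /D; ring.
Qed.

(** Y is the monomial [lmon a] times 1 plus a small series. The three conclusions serve
    invertibility, agreement with the expansion prescribed by [invU], and control of the support for
    residues. *)
Lemma invU_spec a Y : small (lmon (- a) * Y - 1) ->
  [/\ Y \is a GRing.unit, lval Y^-1 = invU (lval (lmon (- a))) (lval Y) &
   forall M, addpred M -> M (- a) -> supp_in M (lmon (- a) * Y - 1) -> supp_in M Y^-1].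
Proof.
move=> h; have := small_unit h; have e : 1 + (lmon (- a) * Y - 1) = lmon (- a) * Y.
  by rewrite addrC subrK.
rewrite e unitrM => /andP[_ YU].
have YE : Y^-1 = lmon (- a) * (1 + (lmon (- a) * Y - 1))^-1.
  by rewrite e invrM ?lmon_unit // mulrCA mulrV ?lmon_unit // mulr1.
split=> //; first by rewrite YE lvalM lval_geom.
move=> M addM Ma hM; rewrite YE; apply: supp_inM => //; first exact: supp_in_lmon.
exact: supp_in_geom.
Qed.

Lemma lbeta_lvar_in M v : addpred M -> M (ue n 1) -> M (ue v 1) ->
  supp_in M (lbeta * lvar v).
Proof. by move=> addM Mb Mv; apply: supp_inM => //; apply: supp_in_lmon. Qed.

Lemma inv_1beta_in M v : geo v -> addpred M -> M (ue n 1) -> M (ue v 1) ->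
  supp_in M (1 + lbeta * lvar v)^-1.
Proof.
by move=> gv *; apply: supp_in_geom => //; [apply: small_beta | apply: lbeta_lvar_in].
Qed.

Lemma inv_sub v w : geo v -> geo w -> (vpos v < vpos w)%N ->
  (lvar v - lvar w \is a GRing.unit) /\
  forall M, addpred M -> M (ue v (- 1)) -> M (ue w 1) -> supp_in M (lvar v - lvar w)^-1.
Proof.
move=> gv gw vw; have E : lmon (- ue v 1) * (lvar v - lvar w) - 1 = - ((lvar v)^-1 * lvar w).
  by rewrite lmonN mulrBr mulVr ?lvar_unit // addrC addKr.
have [] := @invU_spec (ue v 1) (lvar v - lvar w).
  by rewrite E; apply/smallN/small_ratio.
move=> U _ S; split=> // M addM Mv Mw; apply: S => //; first by rewrite -ueN.
rewrite E lvarV; apply: supp_inN; apply: supp_inM => //; exact: supp_in_lmon.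
Qed.

Lemma inv_opl v w : geo v -> geo w -> (vpos v < vpos w)%N ->
  [/\ opl (lvar v) (lvar w) \is a GRing.unit,
   lval (opl (lvar v) (lvar w))^-1 =
     invU (mono v (-1)) (oplus (mono v 1) (mono w 1)) &
  forall M, addpred M -> M (ue n 1) -> M (ue v (- 1)) -> M (ue w 1) ->
    supp_in M (opl (lvar v) (lvar w))^-1].
Proof.
move=> gv gw vw.
have E : lmon (- ue v 1) * opl (lvar v) (lvar w) - 1 =
    (lvar v)^-1 * lvar w + lbeta * lvar w.
  rewrite lmonN -/(lvar v) /opl.
  transitivity ((lvar v)^-1 * lvar v - 1 + (lvar v)^-1 * lvar w +
    lbeta * lvar w * ((lvar v)^-1 * lvar v)); first by ring.
  by rewrite mulVr ?lvar_unit // subrr add0r mulr1.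
have [] := @invU_spec (ue v 1) (opl (lvar v) (lvar w)).
  by rewrite E; apply: smallD; [apply: small_ratio | apply: small_beta].
rewrite -ueN => U LV S; split=> // M addM Mb Mv Mw; apply: S => //; rewrite ueN E.
by rewrite lvarV; apply: supp_inD; apply: supp_inM => //; exact: supp_in_lmon.
Qed.

Lemma inv_omn v w : geo v -> geo w -> (vpos v < vpos w)%N ->
   lval (omn (lvar v) (lvar w))^-1 =
     invU (mono v (-1)) (ominus (mono v 1) (mono w 1)).
Proof.
move=> gv gw vw; have hb := small_beta gw.
have E : lmon (- ue v 1) * omn (lvar v) (lvar w) - 1 =
    - ((lbeta * lvar w + (lvar v)^-1 * lvar w) * (1 + lbeta * lvar w)^-1).
  rewrite omnE // lmonN -/(lvar v).
  apply: (mulIr (small_unit hb)).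
  rewrite mulNr mulrVK ?small_unit // mulrBl mul1r mulrA mulrVK ?small_unit //.
  by rewrite mulrBr mulVr ?lvar_unit //; ring.
have [] := @invU_spec (ue v 1) (omn (lvar v) (lvar w)).
  rewrite E; apply/smallN/smallM.
    by apply: smallD; [apply: small_beta | apply: small_ratio].
  by apply: supp_in_geom => //; [apply: addpred_nonnegL | apply: small_nonneg].
by move=> _ -> _; rewrite -ueN lval_omn.
Qed.

Definition fre v e := e v = 0.
Definition reg v e := 0 <= e v.

Lemma addpred_fre v : addpred (fre v).
Proof. by split=> [|a b]; rewrite /fre ffunE // => -> ->. Qed.

Lemma addpred_reg v : addpred (reg v).
Proof. by split=> [|a b]; rewrite /reg ffunE //; apply: addr_ge0. Qed.

Lemma addpred_npos v : addpred (fun e => e v <= 0).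
Proof.
split=> [|a b]; rewrite ffunE // => h1 h2.
by rewrite -[0]addr0 lerD.
Qed.

Lemma fre_reg v F : supp_in (fre v) F -> supp_in (reg v) F.
Proof. by apply: sub_supp_in => e; rewrite /reg => ->. Qed.

Lemma fre_ue v j z : val v != j -> fre v (ue j z).
Proof. by rewrite /fre ueE => /negbTE ->. Qed.

Lemma reg_ue v j z : 0 <= z -> reg v (ue j z).
Proof. by rewrite /reg ueE; case: ifP. Qed.

Lemma good_res v F : good (fun e => if e v == 0 then lval F (e - ue v 1) else 0).
Proof.
have [N hN] := lvalP F; exists N.+1 => e; case: ifP; last by rewrite eqxx.
move=> _ /hN h t; have := h t; rewrite LB L_ue mulr1 /Lcoef.
by case: ifP => _; [|case: ifP => _]; lia.
Qed.

(* the coefficient of [v^-1] *)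
Definition res v F : lser := LSer (good_res v F).

Lemma resE v F e : lval (res v F) e = if e v == 0 then lval F (e - ue v 1) else 0.
Proof. by []. Qed.

Lemma resD v F G : res v (F + G) = res v F + res v G.
Proof.
apply: lser_ext => e; rewrite !lvalD /sadd !resE lvalD /sadd.
by case: ifP; rewrite ?addr0.
Qed.

Lemma res0 v : res v 0 = 0.
Proof. by apply: lser_ext => e; rewrite resE !lval0E; case: ifP. Qed.

Lemma res_sum v (I : Type) (r : seq I) (P : pred I) (F : I -> lser) :
  res v (\sum_(i <- r | P i) F i) = \sum_(i <- r | P i) res v (F i).
Proof. by apply: (big_morph (res v)); [exact: resD | exact: res0]. Qed.

Lemma res_freM v C F : supp_in (fre v) C -> res v (C * F) = C * res v F.
Proof.
move=> hC; apply: lser_ext => e; rewrite resE !lvalM /smul.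
have E e1 : lval C e1 * lval (res v F) (exp_sub e e1) =
   if e v == 0 then lval C e1 * lval F (exp_sub (e - ue v 1) e1) else 0.
  case: (eqVneq (lval C e1) 0) => [->|/hC h]; first by rewrite !mul0r if_same.
  rewrite resE !exp_subE !ffunE h subr0; case: ifP => _; rewrite ?mulr0 //.
  by rewrite addrAC.
under [RHS]eq_zsum do rewrite E.
case: ifP => // _; symmetry; apply: contrapT => /eqP/zsum_neq0[i].
by rewrite eqxx.
Qed.

Lemma res_supp v F : supp_in (fun e => e v != -1) F -> res v F = 0.
Proof.
move=> h; apply: lser_ext => e; rewrite resE lval0E; case: ifP => // /eqP e0.
apply/eqP; apply: contraT => /h; rewrite !ffunE e0 eqxx sub0r eqxx //.
Qed.

Lemma res_reg v F : supp_in (reg v) F -> res v F = 0.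
Proof. by move=> h; apply: res_supp; apply: sub_supp_in h => e; rewrite /reg; lia. Qed.

(** Write 1/(v - w) = 1/v + w v^-2 s with s = 1/(1 - w/v). Only nonpositive powers of v occur in s,
    so the second term has no v^-1. *)
Lemma res_pole v w : geo v -> geo w -> (vpos v < vpos w)%N ->
  res v (lvar v - lvar w)^-1 = 1.
Proof.
move=> gv gw vw; have [U _] := inv_sub gv gw vw.
have hs := smallN (small_ratio gv gw vw).
pose s := (1 - (lvar v)^-1 * lvar w)^-1.
have vw' : v != w by apply: contraTneq vw => ->; rewrite ltnn.
have E : (lvar v - lvar w)^-1 = (lvar v)^-1 + lvar w * (lmon (ue v (- 2)) * s).
  have -> : lmon (ue v (- 2)) = (lvar v)^-1 * (lvar v)^-1.
    rewrite lvarV -lmonD; congr lmon; apply/ffunP => j; rewrite !ffunE.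
    by case: ifP; rewrite ?addr0.
  apply: (mulIr U); rewrite mulVr // /s.
  have -> : lvar v - lvar w = lvar v * (1 - (lvar v)^-1 * lvar w).
    by rewrite mulrBr mulr1 mulrA mulrV ?lvar_unit // mul1r.
  have U1 := small_unit hs; set q := 1 - _ in U1 *.
  have e1 : lvar v * (lvar v)^-1 = 1 by rewrite mulrV ?lvar_unit.
  transitivity (lvar v * (lvar v)^-1 * q + (lvar v)^-1 * lvar w * (lvar v * (lvar v)^-1) * (q^-1 * q)).
    by rewrite e1 mulVr // /q; ring.
  by ring.
rewrite E resD res_freM ?(@res_supp v (_ * s)) ?mulr0 ?addr0; last first.
- by apply: supp_in_lmon; apply: fre_ue; rewrite val_eqE.
- move=> e; rewrite lval_lmonM => h.
  have : supp_in (fun e => e v <= 0) s.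
    apply: supp_in_geom => //; first exact: addpred_npos.
    apply: supp_inN; apply: supp_inM; first exact: addpred_npos.
      by rewrite lvarV; apply: supp_in_lmon; rewrite ueE eqxx.
    by apply: supp_in_lmon; rewrite ueE val_eqE (negbTE vw').
  by move=> /(_ _ h); rewrite !ffunE eqxx; apply: contraTneq => ->.
rewrite lvarV; apply: lser_ext => e; rewrite resE lval_lmon lval1 /sc e0E.
rewrite subr_eq ueN addNr; case: ifP => // h.
by have [e0|//] := eqVneq e 0; rewrite e0 ffunE eqxx in h.
Qed.

End Variables.

(** * Evaluation of the entries *)

Lemma binz_negS d k : binz (- (d.+1)%:Z) k = (-1) ^+ k * ('C(d + k, k))%:Z.
Proof.
rewrite /binz; have -> : \prod_(t < k) (- (d.+1)%:Z - t%:Z) =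
    (-1) ^+ k * ('C(d + k, k))%:Z * (k`!)%:Z.
  rewrite -mulrA -PoszM bin_ffact; elim: k => [|k IH]; first by rewrite big_ord0.
  rewrite big_ord_recr /= IH addnS ffactSS PoszM exprS.
  have -> : - (d.+1)%:Z - k%:Z = - ((d + k).+1)%:Z by lia.
  by ring.
by rewrite mulzK // eqz_nat -lt0n fact_gt0.
Qed.

Lemma binz0 k : binz 0 k = (k == 0)%:Z.
Proof.
case: k => [|k]; first by rewrite /binz big_ord0.
by rewrite /binz big_ord_recl /= subr0 mul0r div0z.
Qed.

Lemma binz_n0 N : binz N 0 = 1.
Proof. by rewrite /binz big_ord0. Qed.

(** The coefficient form of (1 + z)^-(d+1) (1 + z) = (1 + z)^-d. *)
Lemma binz_neg_pascal d k :
  binz (- (d.+1)%:Z) k.+1 + binz (- (d.+1)%:Z) k = binz (- d%:Z) k.+1.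
Proof.
rewrite !binz_negS; case: d => [|d].
  by rewrite oppr0 binz0 !add0n !binn exprS mulN1r mulNr addNr.
rewrite binz_negS !addSn addnS [in X in X + _]binS PoszD exprS; ring.
Qed.

(** * Substitution at a pole and residues at simple poles *)

Section Residues.
Variables n K : nat.
Local Notation expo := (expo n K).
Local Notation lser := (lser n K).
Local Notation nvars := (nvars n K).
Implicit Types (e a b : expo) (v w : 'I_nvars) (F G : lser) (M : expo -> Prop).
Local Notation ue := (unit_exp n K).
Local Notation lvar := (@lvar n K).

Lemma inv_sub_neq v w : geo v -> geo w -> v != w ->
  (lvar v - lvar w \is a GRing.unit) /\
  forall M, addpred M -> (forall z, M (ue v z)) -> (forall z, M (ue w z)) ->
    supp_in M (lvar v - lvar w)^-1.
Proof.
move=> gv gw nvw; case: (ltngtP (vpos v) (vpos w)) => [h|h|/vpos_inj e].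
- by have [U S] := inv_sub gv gw h; split=> // M *; apply: S.
- have [U S] := inv_sub gw gv h; rewrite -opprB unitrN; split=> // M *.
  by rewrite invrN; apply: supp_inN; apply: S.
- by rewrite e eqxx in nvw.
Qed.

Lemma opl_unit_neq v w : geo v -> geo w -> v != w ->
  opl (lvar v) (lvar w) \is a GRing.unit.
Proof.
move=> gv gw nvw; case: (ltngtP (vpos v) (vpos w)) => [h|h|/vpos_inj e].
- by have [U _ _] := inv_opl gv gw h.
- have [U _ _] := inv_opl gw gv h.
  by rewrite /opl (addrC (lvar v)) (mulrC (lvar v)).
- by rewrite e eqxx in nvw.
Qed.

(* [F] is congruent to [c] modulo [v - w] in the series regular in [v], with [c]
   free of [v]: this stands for "substituting w for v in F gives c". *)
Definition cong v w F c := supp_in (fre v) c /\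
  exists2 h, supp_in (reg v) h & F = c + (lvar v - lvar w) * h.

Lemma cong_const v w c : supp_in (fre v) c -> cong v w c c.
Proof. by move=> h; split=> //; exists 0; [exact: supp_in0 | rewrite mulr0 addr0]. Qed.

Lemma cong_var v w : v != w -> cong v w (lvar v) (lvar w).
Proof.
move=> nvw; split; first by apply: supp_in_lmon; apply: fre_ue; rewrite val_eqE.
exists 1; first exact: supp_in1 (addpred_reg v).
by rewrite mulr1 addrC subrK.
Qed.

Lemma lvar_reg v w : supp_in (reg v) (lvar w).
Proof. by apply: supp_in_lmon; apply: reg_ue. Qed.

Lemma congD v w F G c d : cong v w F c -> cong v w G d -> cong v w (F + G) (c + d).
Proof.
move=> [hc [h hh ->]] [hd [k hk ->]]; split; first exact: supp_inD.
by exists (h + k); [exact: supp_inD | ring].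
Qed.

Lemma congN v w F c : cong v w F c -> cong v w (- F) (- c).
Proof.
move=> [hc [h hh ->]]; split; first exact: supp_inN.
by exists (- h); [exact: supp_inN | ring].
Qed.

Lemma congM v w F G c d : cong v w F c -> cong v w G d -> cong v w (F * G) (c * d).
Proof.
move=> [hc [h hh ->]] [hd [k hk ->]]; have aR := addpred_reg v.
split; first by apply: supp_inM => //; apply: addpred_fre.
exists (c * k + h * d + (lvar v - lvar w) * h * k); last by ring.
have hcR := fre_reg hc; have hdR := fre_reg hd.
apply: supp_inD; first by apply: supp_inD; apply: supp_inM.
apply: supp_inM => //; apply: supp_inM => //.
by apply: supp_inB; apply: lvar_reg.
Qed.

Lemma congV v w F c : cong v w F c -> F \is a GRing.unit -> c \is a GRing.unit ->
  supp_in (reg v) F^-1 -> supp_in (fre v) c^-1 -> cong v w F^-1 c^-1.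
Proof.
move=> [hc [h hh FE]] FU cU FR cR; split=> //.
exists (- (h * F^-1 * c^-1)).
  have aR := addpred_reg v; apply: supp_inN.
  by apply: supp_inM => //; [apply: supp_inM | apply: fre_reg].
apply: (mulIr FU); rewrite mulVr // mulrDl.
have e : F^-1 * F = 1 by rewrite mulVr.
transitivity (c^-1 * F - (lvar v - lvar w) * h * c^-1 * (F^-1 * F)); last by ring.
rewrite e mulr1 (mulrC _ c^-1) -mulrBr.
by rewrite [X in X - _]FE addrK mulVr.
Qed.

Lemma cong_prod v w (I : Type) (r : seq I) (P : pred I) (F c : I -> lser) :
  (forall i, P i -> cong v w (F i) (c i)) ->
  cong v w (\prod_(i <- r | P i) F i) (\prod_(i <- r | P i) c i).
Proof.
move=> h; elim/big_ind2: _ => //; last by move=> *; apply: congM.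
by apply: cong_const; apply: supp_in1 (addpred_fre v).
Qed.

Lemma cong_exp v w F c k : cong v w F c -> cong v w (F ^+ k) (c ^+ k).
Proof.
move=> h; elim: k => [|k IH]; last by rewrite !exprS; apply: congM.
by apply: cong_const; apply: supp_in1 (addpred_fre v).
Qed.

Lemma lvar_inj : injective lvar.
Proof.
move=> v w e; have := congr1 (fun F => lval F (ue v 1)) e.
rewrite !lval_lmon eqxx; case: eqP => // /ffunP/(_ v); rewrite !ueE eqxx.
by case: eqP => // /val_inj.
Qed.

Section PartialFractions.
Variables (N : nat) (w : 'I_N -> 'I_nvars).
Hypotheses (N0 : (0 < N)%N) (winj : injective w) (wgeo : forall j, geo (w j)).

Lemma lser_partial_fractions v : geo v -> (forall j, v != w j) ->
  \prod_j (lvar v - lvar (w j))^-1 =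
  \sum_a (lvar v - lvar (w a))^-1 * \prod_(j | j != a) (lvar (w a) - lvar (w j))^-1.
Proof.
move=> gv vw.
have U1 j : lvar v - lvar (w j) \is a GRing.unit.
  by have [] := inv_sub_neq gv (wgeo j) (vw j).
have U2 (a j : 'I_N) : j != a -> lvar (w a) - lvar (w j) \is a GRing.unit.
  move=> nja; have [] // := inv_sub_neq (wgeo a) (wgeo j) _.
  by rewrite (inj_eq winj) eq_sym.
(* All inverses here are inverses of units, so the identity can be checked in the fraction field. *)
apply/eqP; rewrite -tofrac_eq rmorph_prod rmorph_sum /=; apply/eqP.
under eq_bigr => j _ do rewrite rmorphV // rmorphB.
rewrite prodfV (partial_fractions (x := fun j => tofrac (lvar (w j)))) //.
- apply: eq_bigr => a _; rewrite rmorphM rmorph_prod rmorphV // rmorphB; congr (_ * _).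
  by apply: eq_bigr => j nja; rewrite rmorphV ?U2 // rmorphB.
- by move=> i j /eqP; rewrite tofrac_eq => /eqP/lvar_inj/winj.
- by move=> j; rewrite tofrac_eq (inj_eq lvar_inj).
Qed.

(** Each partial fraction splits into [c a] over [v - w a] and a part regular in v, which has no
    residue. As v precedes every [w j], all the poles are expanded in the direction in which they
    count. *)
Lemma res_simple_poles v F (c : 'I_N -> lser) : geo v ->
  (forall j, (vpos v < vpos (w j))%N) -> (forall j, cong v (w j) F (c j)) ->
  res v (F * \prod_j (lvar v - lvar (w j))^-1) =
  \sum_a c a * \prod_(j | j != a) (lvar (w a) - lvar (w j))^-1.
Proof.
move=> gv vw Fc.
have vw' j : v != w j by apply: contraTneq (vw j) => ->; rewrite ltnn.
rewrite lser_partial_fractions // mulr_sumr res_sum; apply: eq_bigr => a _.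
set E := \prod_(j | _) _.
have hE : supp_in (fre v) E.
  apply: supp_in_prod; first exact: addpred_fre.
  move=> j nja; have nw : w a != w j by rewrite (inj_eq winj) eq_sym.
  have [_ S] := inv_sub_neq (wgeo a) (wgeo j) nw.
  by apply: S => [|z|z]; [exact: addpred_fre | apply: fre_ue; rewrite val_eqE..].
have [U _] := inv_sub gv (wgeo a) (vw a).
have [hc [h hh ->]] := Fc a.
have -> : (c a + (lvar v - lvar (w a)) * h) * ((lvar v - lvar (w a))^-1 * E) =
    (c a * E) * (lvar v - lvar (w a))^-1 + E * h.
  transitivity (c a * E * (lvar v - lvar (w a))^-1 +
    E * h * ((lvar v - lvar (w a)) * (lvar v - lvar (w a))^-1)); first by ring.
  by rewrite mulrV // mulr1.
rewrite resD !res_freM //; last by apply: supp_inM => //; apply: addpred_fre.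
by rewrite res_pole // (res_reg hh) mulr0 mulr1 addr0.
Qed.

End PartialFractions.

End Residues.

(** * Binomial series, and numerators evaluated at poles *)

Section PoleValues.
Variables n K : nat.
Local Notation expo := (expo n K).
Local Notation ser := (ser n K).
Local Notation lser := (lser n K).
Local Notation nvars := (nvars n K).
Implicit Types (e : expo) (v w : 'I_nvars) (F G : lser) (M : expo -> Prop).
Local Notation ue := (unit_exp n K).
Local Notation lvar := (@lvar n K).
Local Notation lbeta := (@lbeta n K).
Local Notation vbeta := (vbeta n K).

Definition bgen v : expo := ue n 1 + ue v 1.

Lemma bgenMn_beta v k : geo v -> (bgen v *+ k) vbeta = k%:Z.
Proof.
move=> gv; rewrite ffunMnE /bgen !ffunE eqxx /= eq_sym (negbTE gv) addr0.
by rewrite natz.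
Qed.

Lemma bgenMn_inj v : geo v -> injective (fun k => bgen v *+ k).
Proof.
by move=> gv i j e; have := bgenMn_beta i gv; rewrite e bgenMn_beta // => -[].
Qed.

(** The binomial series of (1 + beta v)^-d in powers of beta v; the power is recovered as the
    exponent of beta. *)
Definition binser_fun d v : ser := fun e =>
  if e == bgen v *+ absz (e vbeta) then binz (- d%:Z) (absz (e vbeta)) else 0.

Lemma LMn t e k : L t (e *+ k) = L t e *+ k.
Proof. by elim: k => [|k IH]; rewrite ?mulr0n ?L0 // !mulrS LD IH. Qed.

Lemma binser_good d v : geo v -> good (binser_fun d v).
Proof.
move=> gv; exists 0%N => e; rewrite /binser_fun.
have [e1 _ t|ne] := eqVneq e (bgen v *+ absz (e vbeta)); last by rewrite eqxx.
by rewrite e1 LMn oppr0 mulrn_wge0 // /bgen LD L_beta L_geo //; case: ifP.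
Qed.

Definition binser d v (gv : geo v) : lser := LSer (binser_good d gv).

Lemma binserE d v (gv : geo v) k : lval (binser d gv) (bgen v *+ k) = binz (- d%:Z) k.
Proof. by rewrite /= /binser_fun bgenMn_beta //= eqxx. Qed.

Lemma binser_supp d v (gv : geo v) e :
  lval (binser d gv) e != 0 -> exists k, e = bgen v *+ k.
Proof.
rewrite /= /binser_fun.
have [e1 _|ne] := eqVneq e (bgen v *+ absz (e vbeta)); last by rewrite eqxx.
by exists (absz (e vbeta)).
Qed.

Lemma binser0 v (gv : geo v) : binser 0 gv = 1.
Proof.
apply: lser_ext => e; rewrite lval1 /sc e0E.
have [->|ne] := eqVneq e 0; first by rewrite -(mulr0n (bgen v)) binserE binz0.
apply/eqP; apply: contraT => h; have [k ek] := binser_supp h; move: h ne.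
by rewrite ek binserE oppr0 binz0; case: k {ek} => [|k] //=; rewrite mulr0n eqxx.
Qed.

Lemma binserS d v (gv : geo v) : binser d.+1 gv * (1 + lbeta * lvar v) = binser d gv.
Proof.
apply: lser_ext => e; rewrite mulrDr mulr1 [X in _ + X]mulrC lvalD /sadd.
rewrite -lmonD lval_lmonM -/(bgen v).
have neg1 : lval (binser d.+1 gv) (- bgen v) = 0.
  apply/eqP; apply: contraT => /binser_supp[k /(congr1 (fun e : expo => e vbeta))].
  by rewrite bgenMn_beta // ffunE -[bgen v]mulr1n bgenMn_beta.
case: (pselect (exists k, e = bgen v *+ k)) => [[k ->]|nk].
  case: k => [|k].
    by rewrite binserE mulr0n sub0r neg1 addr0 -(mulr0n (bgen v)) binserE !binz_n0.
  have -> : bgen v *+ k.+1 - bgen v = bgen v *+ k by rewrite mulrSr addrK.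
  by rewrite !binserE binz_neg_pascal.
have z d' e' : (forall k, e' != bgen v *+ k) -> lval (binser d' gv) e' = 0.
  move=> ne; apply/eqP; apply: contraT => /binser_supp[k ek].
  by move: (ne k); rewrite ek eqxx.
have nk' k : e != bgen v *+ k by apply/eqP => ek; case: nk; exists k.
rewrite !z ?addr0 // => k; apply/eqP => ek; case: nk; exists k.+1.
by rewrite mulrS -ek addrC subrK.
Qed.

Lemma binser_exp d v (gv : geo v) : (1 + lbeta * lvar v)^-1 ^+ d = binser d gv.
Proof.
have U := small_unit (small_beta gv).
elim: d => [|d IH]; first by rewrite binser0.
by apply: (mulIr U); rewrite binserS exprSr mulrVK.
Qed.

(** The bridge between the binomial sums of the theorem and powers of 1/(1 + beta v): only exponents
    [bgen v *+ k] occur in the first factor, so the convolution becomes a sum over k. *)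
Lemma binser_mulE d v F e : geo v ->
  lval ((1 + lbeta * lvar v)^-1 ^+ d * F) e =
  zsum (fun k : nat => binz (- d%:Z) k * lval F (e - bgen v *+ k)).
Proof.
move=> gv; rewrite binser_exp lvalM /smul.
rewrite (@zsum_reindex _ _ (fun k : nat => bgen v *+ k)).
- by apply: eq_zsum => k; rewrite -(binserE d gv k) -exp_subE.
- exact: bgenMn_inj.
- by move=> e1; rewrite mulf_eq0 negb_or => /andP[/binser_supp].
have [s hs] := conv_fin e (lvalP (binser d gv)) (lvalP F).
exists [seq absz (e1 vbeta) | e1 : expo <- s] => k /= /hs h.
by apply/mapP; exists (bgen v *+ k); rewrite ?bgenMn_beta.
Qed.

Lemma vu1_lt : (iU1 n K < nvars)%N. Proof. by rewrite /iU1 /nvars; lia. Qed.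
Lemma vu2_lt : (iU2 n K < nvars)%N. Proof. by rewrite /iU2 /nvars; lia. Qed.
Lemma vx_lt (j : 'I_n) : (j < nvars)%N.
Proof. by rewrite /nvars; have := ltn_ord j; lia. Qed.

Definition vu1 : 'I_nvars := Ordinal vu1_lt.
Definition vu2 : 'I_nvars := Ordinal vu2_lt.
Definition vx j : 'I_nvars := Ordinal (vx_lt j).

Lemma vx_inj : injective vx.
Proof. by move=> i j /(congr1 val) /= e; apply: val_inj. Qed.

Lemma geo_u1 : geo vu1. Proof. by rewrite /geo /= /iU1; lia. Qed.
Lemma geo_u2 : geo vu2. Proof. by rewrite /geo /= /iU2; lia. Qed.
Lemma geo_x j : geo (vx j). Proof. by rewrite /geo /= ltn_eqF. Qed.
Hint Resolve geo_u1 geo_u2 geo_x : core.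

Lemma vpos_u1 : vpos vu1 = 2%N.
Proof. by rewrite /vpos /= /iU1 /iU2; repeat (case: ifP => ?); lia. Qed.
Lemma vpos_u2 : vpos vu2 = 1%N.
Proof. by rewrite /vpos /= /iU2; repeat (case: ifP => ?); lia. Qed.
Lemma vpos_x j : vpos (vx j) = (j.+3)%N.
Proof.
have := ltn_ord j; rewrite /vpos /= /iU1 /iU2; move: (val j) => i.
by repeat (case: ifP => ?); lia.
Qed.

Definition lb k : lser := lmon (ue (n + k) 1).

(** Numerator of z^(p-1) G^(p-1)(z) (1 + beta z)^-d over the product of the z - x_j. The 1 in [d.+1]
    is the prefactor 1/(1 + beta z) of G, and the 1 + beta x_j come from z (-) x_j = (z - x_j)/(1 +
    beta x_j). [P] allows a factor z (+) x_a to be left out. *)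
Definition num (P : pred 'I_n) d p (z : lser) : lser :=
  (1 + lbeta * z)^-1 ^+ d.+1 * \prod_(j | P j) opl z (lvar (vx j)) *
  \prod_j (1 + lbeta * lvar (vx j)) * \prod_(1 <= k < p) opl z (lb k).

Lemma cong_opl v w F G c d : geo v -> cong v w F c -> cong v w G d ->
  cong v w (opl F G) (opl c d).
Proof.
move=> gv Fc Gd; apply: congD; first exact: congD.
apply: congM; last exact: congM.
by apply: cong_const; apply: supp_in_lmon; apply: fre_ue.
Qed.

Lemma cong_1beta v w : geo v -> geo w -> v != w ->
  cong v w (1 + lbeta * lvar v)^-1 (1 + lbeta * lvar w)^-1.
Proof.
move=> gv gw vw; apply: congV; try exact/small_unit/small_beta.
- apply: congD; first by apply: cong_const; apply: supp_in1 (addpred_fre v).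
  apply: congM; last exact: cong_var.
  by apply: cong_const; apply: supp_in_lmon; apply: fre_ue.
- by apply: (inv_1beta_in gv (addpred_reg v)); apply: reg_ue.
- apply: (@inv_1beta_in _ _ (fre v)) => //; first exact: addpred_fre.
    exact: fre_ue.
  by apply: fre_ue; rewrite val_eqE.
Qed.

Lemma fre_lvar v w : v != w -> supp_in (fre v) (lvar w).
Proof. by move=> h; apply: supp_in_lmon; apply: fre_ue; rewrite val_eqE. Qed.

Lemma fre_lbeta v : geo v -> supp_in (fre v) lbeta.
Proof. by move=> h; apply: supp_in_lmon; apply: fre_ue. Qed.

Lemma fre_lb v k : (n + K < v)%N -> (k <= K)%N -> supp_in (fre v) (lb k).
Proof. by move=> h hk; apply: supp_in_lmon; apply: fre_ue; rewrite /=; lia. Qed.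

(** The bound on p keeps every [lb k] at an index at most n+K, hence different from v, which is one
    of the u's. *)
Lemma cong_num P d p v j : geo v -> (n + K < v)%N -> (p <= K.+1)%N ->
  cong v (vx j) (num P d p (lvar v)) (num P d p (lvar (vx j))).
Proof.
move=> gv hv pK; have ne i : v != vx i.
  by rewrite -val_eqE /=; have := ltn_ord i; lia.
have cv := @cong_var _ _ v (vx j) (ne j).
have cx i := @cong_const _ _ v (vx j) _ (fre_lvar (ne i)).
rewrite /num; apply: congM; first apply: congM; first apply: congM.
- by apply: cong_exp; apply: cong_1beta.
- by apply: cong_prod => i _; apply: cong_opl.
- apply: cong_const; apply: supp_in_prod; first exact: addpred_fre.
  move=> i _; apply: supp_inD; first exact: supp_in1 (addpred_fre v).
  by apply: supp_inM (addpred_fre v) _ _ _ _; [exact: fre_lbeta | exact: fre_lvar].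
rewrite big_nat_cond [X in cong _ _ _ X]big_nat_cond.
apply: cong_prod => k /andP[/andP[_ kp] _]; apply: cong_opl => //.
by apply: cong_const; apply: fre_lb => //; rewrite -ltnS (leq_trans kp).
Qed.

Lemma fre_opl v F G : geo v -> supp_in (fre v) F -> supp_in (fre v) G ->
  supp_in (fre v) (opl F G).
Proof.
move=> gv hF hG; have aF := addpred_fre v; apply: supp_inD; first exact: supp_inD.
by apply: supp_inM => //; [exact: fre_lbeta | apply: supp_inM].
Qed.

Lemma fre_num P d p v w : geo v -> geo w -> v != w -> (n + K < v)%N -> (p <= K.+1)%N ->
  supp_in (fre v) (num P d p (lvar w)).
Proof.
move=> gv gw nvw hv pK; have aF := addpred_fre v.
have ne i : v != vx i by rewrite -val_eqE /=; have := ltn_ord i; lia.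
have hw := fre_lvar nvw.
rewrite /num; apply: supp_inM => //; first apply: supp_inM => //; first apply: supp_inM => //.
- apply: supp_in_exp => //; apply: inv_1beta_in => //; first exact: fre_ue.
  by apply: fre_ue; rewrite val_eqE.
- by apply: supp_in_prod => // i _; apply: fre_opl => //; apply: fre_lvar.
- apply: supp_in_prod => // i _; apply: supp_inD; first exact: supp_in1.
  by apply: supp_inM => //; [exact: fre_lbeta | exact: fre_lvar].
rewrite big_nat_cond; apply: supp_in_prod => // k /andP[/andP[_ kp] _].
by apply: fre_opl => //; apply: fre_lb => //; rewrite -ltnS (leq_trans kp).
Qed.

End PoleValues.

(** * The entries computed by two residues *)

Section EntryResidues.
Variables n K : nat.
Local Notation expo := (expo n K).
Local Notation lser := (lser n K).
Local Notation nvars := (nvars n K).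
Implicit Types (e : expo) (v w : 'I_nvars) (F G : lser) (M : expo -> Prop).
Local Notation lvar := (@lvar n K).
Local Notation lbeta := (@lbeta n K).
Local Notation vx := (@vx n K).
Local Notation vu1 := (vu1 n K).
Local Notation vu2 := (vu2 n K).
Local Notation num := (@num n K).
Local Notation x j := (lvar (vx j)).
Local Notation u1 := (lvar vu1).
Local Notation u2 := (lvar vu2).
Hint Resolve geo_u1 geo_u2 geo_x : core.

Lemma lval_prod (I : Type) (r : seq I) (P : pred I) (F : I -> lser) :
  lval (\prod_(i <- r | P i) F i) = \big[@smul n K/@sc n K 1]_(i <- r | P i) lval (F i).
Proof. exact: (big_morph _ (@lvalM n K) (@lval1 n K)). Qed.

Definition lG q v : lser := (1 + lbeta * lvar v)^-1 *
  (\prod_(j < n) (opl (lvar v) (x j) * (omn (lvar v) (x j))^-1)) *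
  \prod_(1 <= k < q.+1) (opl (lvar v) (lb n K k) * (lvar v)^-1).

Lemma lval_lG q v : geo v -> (forall j, vpos v < vpos (vx j))%N ->
  lval (lG q v) = Gq q (@mono n K v 1) (@mono n K v (-1)).
Proof.
move=> gv hv; rewrite /lG /Gq !lvalM lval_geom; last exact: small_beta.
congr smul; last first.
  by rewrite lval_prod; apply: eq_bigr => k _; rewrite lvalM lvarV.
congr smul; rewrite lval_prod; apply: eq_bigr => j _.
by rewrite lvalM inv_omn.
Qed.

Lemma lG_num q v : geo v -> (forall j, vpos v < vpos (vx j))%N ->
  lvar v ^+ q * lG q v =
  num xpredT 0 q.+1 (lvar v) * \prod_j (lvar v - x j)^-1.
Proof.
move=> gv hv; rewrite /lG /num expr1 [X in _ * (_ * X)]big_split /=.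
rewrite prodr_const_nat subSS subn0 exprVn.
have -> : \prod_(j < n) (opl (lvar v) (x j) * (omn (lvar v) (x j))^-1) =
  \prod_j opl (lvar v) (x j) * \prod_j (1 + lbeta * x j) * \prod_j (lvar v - x j)^-1.
  rewrite -!big_split; apply: eq_bigr => j _ /=; rewrite -mulrA; congr (_ * _).
  have hb := small_beta (geo_x K j); have U := small_unit hb.
  have [U' _] := inv_sub gv (geo_x K j) (hv j).
  by rewrite omnE // invrM ?unitrV // invrK.
have e : lvar v ^+ q * (lvar v ^+ q)^-1 = 1 by rewrite mulrV // unitrX // lvar_unit.
set A := \prod_(1 <= k < _) _; set B := \prod_j opl _ _; set C := \prod_j (1 + _).
set D := \prod_j _^-1; set E := (1 + _)^-1.
transitivity (E * B * C * A * D * (lvar v ^+ q * (lvar v ^+ q)^-1)); first by ring.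
by rewrite e mulr1.
Qed.

Lemma numE P d p z : num P d p z = (1 + lbeta * z)^-1 ^+ d * num P 0 p z.
Proof. by rewrite /num !mulrA -exprSr. Qed.

Lemma numS P d p z : num P d.+1 p z = (1 + lbeta * z)^-1 * num P d p z.
Proof. by rewrite numE exprS -mulrA -numE. Qed.

Definition lF p q : lser := lG p vu1 * lG q vu2 * (omn u2 u1 * (opl u2 u1)^-1).

Lemma vpos_u1x j : (vpos vu1 < vpos (vx j))%N.
Proof. by rewrite vpos_u1 vpos_x. Qed.
Lemma vpos_u2x j : (vpos vu2 < vpos (vx j))%N.
Proof. by rewrite vpos_u2 vpos_x. Qed.
Lemma vpos_u21 : (vpos vu2 < vpos vu1)%N.
Proof. by rewrite vpos_u1 vpos_u2. Qed.
Hint Resolve vpos_u1x vpos_u2x vpos_u21 : core.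

Lemma lval_lF p q : lval (lF p q) =
  smul (smul (Gq p (@U1 n K) (@U1inv n K)) (Gq q (@U2 n K) (@U2inv n K)))
       (smul (ominus (@U2 n K) (@U1 n K)) (invU (@U2inv n K) (oplus (@U2 n K) (@U1 n K)))).
Proof.
rewrite /lF lvalM (lvalM (lG p vu1)) (lvalM (omn _ _)) !lval_lG // lval_omn; last exact: small_beta.
by have [_ -> _] := inv_opl (geo_u2 n K) (geo_u1 n K) vpos_u21.
Qed.

(** Here p and q stand for nu_i - 1 and nu_j - 1: with the factors u1^p u2^q the residues read off
    the coefficient of u1^-(p+1) u2^-(q+1). *)
Definition lA d1 d2 p q : lser :=
  res vu2 (res vu1 ((1 + lbeta * u1)^-1 ^+ d1 * ((1 + lbeta * u2)^-1 ^+ d2 *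
    (u1 ^+ p * u2 ^+ q * lF p q)))).

Definition Tx d p (a : 'I_n) : lser :=
  num xpredT d p (x a) * \prod_(j | j != a) (x a - x j)^-1.
Definition Sx (a b : 'I_n) : lser := (x b - x a) / opl (x a) (x b).

Lemma oplC F G : opl F G = opl G F.
Proof. by rewrite /opl (addrC F) (mulrC F). Qed.

Lemma vu2x j : vu2 != vx j.
Proof. by apply: contraTneq (vpos_u2x j) => ->; rewrite ltnn. Qed.
Lemma vu1x j : vu1 != vx j.
Proof. by apply: contraTneq (vpos_u1x j) => ->; rewrite ltnn. Qed.
Lemma vu1u2 : vu1 != vu2.
Proof. by apply: contraTneq vpos_u21 => ->; rewrite ltnn. Qed.
Hint Resolve vu2x vu1x vu1u2 : core.

Lemma num_split d p (a : 'I_n) z :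
  num xpredT d p z = opl z (x a) * num (fun j => j != a) d p z.
Proof. by rewrite /num (bigD1 a) //=; ring. Qed.

Lemma ltKu1 : (n + K < vu1)%N. Proof. by rewrite /= /iU1; lia. Qed.
Lemma ltKu2 : (n + K < vu2)%N. Proof. by rewrite /= /iU2; lia. Qed.

Lemma fre_inv_sub v (a j : 'I_n) : v != vx a -> v != vx j -> j != a ->
  supp_in (fre v) (x a - x j)^-1.
Proof.
move=> va vj ja; have nw : vx a != vx j by rewrite (inj_eq (@vx_inj n K)) eq_sym.
have [_ S] := inv_sub_neq (geo_x K a) (geo_x K j) nw.
by apply: S => [|z|z]; [exact: addpred_fre | apply: fre_ue; rewrite val_eqE..].
Qed.

(** The exponent [d1] becomes [d1.+1] because u2 (-) u1 contributes 1/(1 + beta u1); nothing similar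
    happens in u2. *)
Lemma lA_eq d1 d2 p q : (0 < n)%N -> (p <= K)%N -> (q <= K)%N ->
  lA d1 d2 p q = \sum_a \sum_b Tx d1.+1 p.+1 a * Tx d2 q.+1 b * Sx a b.
Proof.
move=> n0 pK qK; rewrite /lA /lF.
have hb1 := small_beta (geo_u1 n K).
have [U21 _ S21] := inv_opl (geo_u2 n K) (geo_u1 n K) vpos_u21.
have a1 := addpred_fre vu1; have a2 := addpred_fre vu2.
(* C is free of u1. F1 is regular in u1, the kernel being expanded in powers of u1, so the zero of
   u2 (+) u1 yields no residue; [c1 a] is the value of F1 at u1 = x_a. *)
pose C := num xpredT d2 q.+1 u2 * \prod_j (u2 - x j)^-1.
pose F1 := num xpredT d1 p.+1 u1 * ((u2 - u1) * (1 + lbeta * u1)^-1 * (opl u2 u1)^-1).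
pose c1 a := num xpredT d1 p.+1 (x a) *
  ((u2 - x a) * (1 + lbeta * x a)^-1 * (opl u2 (x a))^-1).
have -> : (1 + lbeta * u1)^-1 ^+ d1 * ((1 + lbeta * u2)^-1 ^+ d2 *
    (u1 ^+ p * u2 ^+ q * (lG p vu1 * lG q vu2 * (omn u2 u1 * (opl u2 u1)^-1)))) =
    C * (F1 * \prod_j (u1 - x j)^-1).
  rewrite omnE //.
  transitivity ((1 + lbeta * u1)^-1 ^+ d1 * ((1 + lbeta * u2)^-1 ^+ d2 *
    ((u1 ^+ p * lG p vu1) * (u2 ^+ q * lG q vu2) *
     ((u2 - u1) * (1 + lbeta * u1)^-1 * (opl u2 u1)^-1)))); first by ring.
  rewrite !lG_num // /C /F1 (numE xpredT d1) (numE xpredT d2); ring.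
have hC : supp_in (fre vu1) C.
  apply: supp_inM => //; first by apply: fre_num => //; exact: ltKu1.
  apply: supp_in_prod => // j _.
  have [_ S] := inv_sub (geo_u2 n K) (geo_x K j) (vpos_u2x j).
  by apply: S => //; apply: fre_ue; rewrite val_eqE.
rewrite res_freM // (@res_simple_poles _ _ _ vx n0 (@vx_inj n K) _ _ _ c1) //; last first.
  move=> j; apply: congM; first by apply: cong_num => //; exact: ltKu1.
  have c2 : cong vu1 (vx j) u2 u2 by apply: cong_const; apply: fre_lvar.
  have cv : cong vu1 (vx j) u1 (x j) by apply: cong_var.
  apply: congM; first apply: congM.
  - by apply: congD => //; apply: congN.
  - exact: cong_1beta.
  have [U' _ S'] := inv_opl (geo_u2 n K) (geo_x K j) (vpos_u2x j).
  apply: congV => //; first exact: cong_opl.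
  - apply: (S21 (reg vu1)); first exact: addpred_reg.
    + exact: reg_ue.
    + by rewrite /reg ueE (negbTE (vu1u2 : val vu1 != val vu2)).
    + exact: reg_ue.
  - apply: S' => //; first by apply: fre_ue; exact: geo_u1.
    + by apply: fre_ue; rewrite val_eqE.
    + by apply: fre_ue; rewrite val_eqE.
rewrite mulr_sumr res_sum; apply: eq_bigr => a _.
have [U2a _ _] := inv_opl (geo_u2 n K) (geo_x K a) (vpos_u2x a).
set E := \prod_(j | _) _.
have hE : supp_in (fre vu2) E.
  by apply: supp_in_prod => // j ja; apply: fre_inv_sub.
pose D := num xpredT d1 p.+1 (x a) * (1 + lbeta * x a)^-1 * E.
have hD : supp_in (fre vu2) D.
  apply: supp_inM => //; apply: supp_inM => //; first by apply: fre_num => //; exact: ltKu2.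
  apply: inv_1beta_in => //; first by apply: fre_ue; exact: geo_u2.
  by apply: fre_ue; rewrite val_eqE.
(* [num_split] extracts from C the factor [opl u2 (x a)] that clears the denominator, which makes
   the rest regular in u2. *)
have -> : C * (c1 a * E) = D * (((u2 - x a) * num (fun j => j != a) d2 q.+1 u2) *
    \prod_j (u2 - x j)^-1).
  rewrite /C /c1 (num_split d2 _ a u2).
  transitivity (D * (((u2 - x a) * num (fun j => j != a) d2 q.+1 u2) *
    \prod_j (u2 - x j)^-1) * (opl u2 (x a) * (opl u2 (x a))^-1)).
    by rewrite /D; ring.
  by rewrite mulrV // mulr1.
pose c2 b := (x b - x a) * num (fun j => j != a) d2 q.+1 (x b).
rewrite res_freM // (@res_simple_poles _ _ _ vx n0 (@vx_inj n K) _ _ _ c2) //; last first.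
  move=> j; apply: congM; last by apply: cong_num => //; exact: ltKu2.
  apply: congD; first exact: cong_var.
  by apply: cong_const; apply: supp_inN; apply: fre_lvar.
rewrite mulr_sumr; apply: eq_bigr => b _.
rewrite /Tx numS -/E /c2 /Sx /D.
(* On the diagonal x_a (+) x_a = x_a (2 + beta x_a) is not a unit over the integers, but the
   numerators vanish on both sides. *)
have [->|nab] := eqVneq a b; first by rewrite subrr !(mul0r, mulr0).
have Uab : opl (x a) (x b) \is a GRing.unit.
  by apply: opl_unit_neq => //; rewrite (inj_eq (@vx_inj n K)).
rewrite (num_split d2 _ a (x b)) (oplC (x b)).
set O := opl (x a) (x b) in Uab *.
set P := num _ d2 _ _; set Q := num _ d1 _ _; set R := \prod_(j | j != b) _.
set B := (1 + _)^-1.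
transitivity (Q * B * E * ((x b - x a) * P * R) * (O * O^-1)); last by ring.
by rewrite mulrV // mulr1.
Qed.

End EntryResidues.

(** * The Pfaffian as a sum over cosets *)

(** For each i the factors with j > i are the wanted ones. Those with j < i, reindexed by exchanging
    i and j, meet each pair i < j < r once, together with one [S i j] and one of the [r - i.+1]
    copies of [g i]; these three multiply to 1. *)
Lemma prod_cancel_pairs (R : comNzRingType) n r (E S : 'I_n -> 'I_n -> R) (g : 'I_n -> R) :
  (r <= n)%N -> (forall i j : 'I_n, (i < j)%N -> E j i * S i j * g i = 1) ->
  \prod_(i < n | (i < r)%N) (g i ^+ (r - i.+1) * \prod_(j < n | j != i) E i j) *
  \prod_(i < n | (i < r)%N) \prod_(j < n | (i < j)%N && (j < r)%N) S i j =
  \prod_(i < n | (i < r)%N) \prod_(j < n | (i < j)%N) E i j.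
Proof.
move=> rn ESg.
have gE (i : 'I_n) : (i < r)%N ->
    g i ^+ (r - i.+1) = \prod_(j < n | (i < j)%N && (j < r)%N) g i.
  move=> ir; rewrite prodr_const; congr (_ ^+ _).
  rewrite -sum1_card (big_ord_narrow_cond (P := fun j : 'I_n => (i < j)%N) rn).
  transitivity (\sum_(i.+1 <= j < r) 1)%N; first by rewrite sum_nat_const_nat muln1.
  by rewrite big_geq_mkord.
have splitE (i : 'I_n) : \prod_(j < n | j != i) E i j =
    \prod_(j < n | (i < j)%N) E i j * \prod_(j < n | (j < i)%N) E i j.
  rewrite (bigID (fun j : 'I_n => (i < j)%N)) /=; congr (_ * _); apply: eq_bigl => j;
    by rewrite -val_eqE; case: ltngtP.
under eq_bigr => i ir do rewrite gE // splitE mulrCA.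
rewrite big_split -[RHS]mulr1 -mulrA; congr (_ * _).
rewrite big_split /=.
have -> : \prod_(i < n | (i < r)%N) \prod_(j < n | (j < i)%N) E i j =
    \prod_(i < n | (i < r)%N) \prod_(j < n | (i < j)%N && (j < r)%N) E j i.
  rewrite (exchange_big_dep (fun j : 'I_n => (j < r)%N)) /=.
    by apply: eq_bigr => i ir; apply: eq_bigl => j; rewrite andbC.
  by move=> i j ir ji; apply: ltn_trans ir.
rewrite -!big_split /= big1 // => i ir; rewrite -!big_split big1 //= => j /andP[ij jr].
by rewrite -(ESg i j ij); ring.
Qed.

Lemma rmorph_pfaff (R R' : comNzRingType) (f : {rmorphism R -> R'}) m (A : nat -> nat -> R) :
  f (pfaff m A) = pfaff m (fun i j => f (A i j)).
Proof.
rewrite rmorph_sum; apply: eq_bigr => s _; rewrite rmorphM rmorph_sign; congr (_ * _).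
by rewrite rmorph_prod.
Qed.

(** * The double binomial sums as iterated residues *)

Section EntryExpansion.
Variables n K : nat.
Local Notation expo := (expo n K).
Local Notation ser := (ser n K).
Local Notation lser := (lser n K).
Local Notation nvars := (nvars n K).
Implicit Types (e : expo) (v w : 'I_nvars) (F G : lser).
Local Notation ue := (unit_exp n K).
Local Notation lvar := (@lvar n K).
Local Notation lbeta := (@lbeta n K).
Local Notation vu1 := (vu1 n K).
Local Notation vu2 := (vu2 n K).
Hint Resolve geo_u1 geo_u2 geo_x : core.

Section EntrySeries.
Variables d1 d2 p q : nat.

(** The exponent at which [lF] is read for the term (k, l), after the shifts due to the two
    residues, the two binomial series and the monomial u1^p u2^q. *)
Definition entry_exp e (k l : nat) : expo :=
  e - ue vu2 1 - ue vu1 1 - bgen vu1 *+ k - bgen vu2 *+ l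
    - (ue vu1 1 *+ p + ue vu2 1 *+ q).

Definition entry_term e (kl : nat * nat) : int :=
  binz (- d1%:Z) kl.1 * (binz (- d2%:Z) kl.2 * lval (lF n K p q) (entry_exp e kl.1 kl.2)).

(** [L 0] is the exponent of beta: at the exponent read it has dropped by k + l, but on the support
    of [lF] it is bounded below. *)
Lemma entry_term_fin e : finsupp (entry_term e).
Proof.
have [N hN] := lvalP (lF n K p q).
pose B := absz (L 0 e + N%:Z).
exists [seq (k, l) | k <- iota 0 B.+1, l <- iota 0 B.+1] => -[k l].
rewrite !mulf_eq0 !negb_or => /andP[_ /andP[_ /hN/(_ 0%N) h0]].
have h : (k + l)%:Z <= L 0 e + N%:Z.
  move: h0; rewrite /entry_exp !(LB, LD, LMn) L_beta !L_geo // ?vpos_u1 ?vpos_u2 /=.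
  by rewrite !mul0rn ?addr0 ?subr0 !natz; lia.
apply/allpairsP; exists (k, l); rewrite !mem_iota /=; split=> //.
  by rewrite /B; lia.
by rewrite /B; lia.
Qed.

Lemma lval_lA e : (lval (lA n K d1 d2 p q) e) =
  if (e vu1 == 0) && (e vu2 == 0) then zsum (entry_term e) else 0.
Proof.
rewrite /lA resE; case: (eqVneq (e vu2) 0) => e2; last by rewrite andbF.
rewrite resE andbT; have -> : (e - ue vu2 1) vu1 = e vu1.
  by rewrite !ffunE (negbTE (vu1u2 n K : val vu1 != val vu2)) subr0.
case: ifP => // e1; rewrite binser_mulE // zsum_pair; last exact: entry_term_fin.
apply: eq_zsum => k; rewrite binser_mulE // -zsumMl; last first.
  have [s hs] := conv_fin (e - ue vu2 1 - ue vu1 1 - bgen vu1 *+ k)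
    (lvalP ((1 + lbeta * lvar vu2)^-1 ^+ d2))
    (lvalP (lvar vu1 ^+ p * lvar vu2 ^+ q * lF n K p q)).
  exists [seq absz (e1 (vbeta n K)) | e1 : expo <- s] => l h.
  apply/mapP; exists (bgen vu2 *+ l); last by rewrite bgenMn_beta.
  by apply: hs; rewrite binser_exp binserE exp_subE.
apply: eq_zsum => l; congr (_ * (_ * _)).
rewrite -[lvar vu1]/(lmon (ue vu1 1)) -[lvar vu2]/(lmon (ue vu2 1)).
by rewrite -!lmonMn -lmonD lval_lmonM.
Qed.

Lemma spow_beta k : spow (@Beta n K) k = lval (lmon (ue n 1 *+ k)).
Proof. by rewrite lmonMn lval_exp. Qed.

Definition entry_family (kl : nat * nat) : ser :=
  smul (@sc n K (binz (- d1%:Z) kl.1 * binz (- d2%:Z) kl.2))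
       (smul (spow (@Beta n K) (kl.1 + kl.2))
             (@GQpq n K p.+1 q.+1 (p.+1 + kl.1) (q.+1 + kl.2))).

Lemma entry_familyE kl e : entry_family kl e =
  if (e vu1 == 0) && (e vu2 == 0) then entry_term e kl else 0.
Proof.
case: kl => k l; rewrite /entry_family smul_sc spow_beta smul_delta mul1r.
rewrite /GQpq -lval_lF /coef2.
have -> : inord (iU1 n K) = vu1 by apply: val_inj; rewrite /= inordK // vu1_lt.
have -> : inord (iU2 n K) = vu2 by apply: val_inj; rewrite /= inordK // vu2_lt.
have bu v z : geo v -> (e - ue n 1 *+ z) v = e v.
  by move=> gv; rewrite ffunE ffunE ffunMnE ueE (negbTE gv) mul0rn oppr0 addr0.
rewrite !bu //; case: ifP => _; last by rewrite mulr0.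
rewrite -mulrA; congr (_ * (_ * lval _ _)).
apply/ffunP => v; rewrite /entry_exp /bgen !(ffunE, ffunMnE) /=.
have := ltn_ord v; rewrite /iU1 /iU2; move: (e v) => z _.
by do 3![case: ifP => _]; rewrite ?mul0rn ?natz; lia.
Qed.

Lemma entry_family_summable : summable entry_family.
Proof.
move=> e; have [s hs] := entry_term_fin e; exists s => kl.
by rewrite entry_familyE; case: ifP => _; [apply: hs | rewrite eqxx].
Qed.

Lemma fsum_entry_family : fsum entry_family = lval (lA n K d1 d2 p q).
Proof.
apply/funext => e; rewrite /fsum lval_lA.
under eq_zsum do rewrite entry_familyE.
case: ifP => _ //; apply/eqP; apply: contraT => /zsum_neq0[i].
by rewrite eqxx.
Qed.

End EntrySeries.

End EntryExpansion.

Lemma divf_div_mul (F : fieldType) (c a b d : F) : c != 0 -> b != 0 -> d != 0 ->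
  a / b = (c * a / d) / (c * b / d).
Proof. by move=> c0 b0 d0; field; rewrite c0 b0 d0. Qed.

(** * Schur's Pfaffian for the formal group law, and denominators of GQ *)

Section SchurPfaffian.
Variables n K : nat.
Local Notation expo := (expo n K).
Local Notation lser := (lser n K).
Local Notation nvars := (nvars n K).
Implicit Types (e : expo) (v w : 'I_nvars) (F G : lser).
Local Notation lvar := (@lvar n K).
Local Notation lbeta := (@lbeta n K).
Local Notation vx := (@vx n K).
Local Notation x j := (lvar (vx j)).
Local Notation tf := (@tofrac lser).
Hint Resolve geo_u1 geo_u2 geo_x : core.

(** 2 and 2 + beta x are nonzero, as the constant term shows, but are not units; the substitution t
    = x/(2 + beta x) therefore lives in the fraction field. *)
Lemma two_neq0 : 2 != 0 :> lser.
Proof.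
apply/eqP => /(congr1 (fun F => lval F 0)); rewrite lval0E.
by rewrite lvalD /sadd lval1 /sc e0E eqxx.
Qed.

Lemma two_beta_neq0 v : geo v -> 2 + lbeta * lvar v != 0.
Proof.
move=> gv; apply/eqP => /(congr1 (fun F => lval F 0)); rewrite lval0E.
by rewrite -lmonD !lvalD /sadd lval1 /sc e0E eqxx lval_lmon; case: eqP.
Qed.

(** The case v = w is included because [schur_pfaffian] asks for nonzero sums of an entry with
    itself too. *)
Lemma opl_neq0 v w : geo v -> geo w -> opl (lvar v) (lvar w) != 0.
Proof.
move=> gv gw; have [<-|nvw] := eqVneq v w; last first.
  by apply: contraTneq (opl_unit_neq gv gw nvw) => ->; rewrite unitr0.
have -> : opl (lvar v) (lvar v) = lvar v * (2 + lbeta * lvar v) by rewrite /opl; ring.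
rewrite mulf_neq0 ?two_beta_neq0 //.
by apply: contraTneq (lvar_unit v) => ->; rewrite unitr0.
Qed.

(* [t = x / (2 + beta x)] linearises the formal group law: up to nonzero factors,
   [x - y] becomes [t - t'] and the formal sum of x and y becomes [t + t']. *)
Definition schur_var (a : 'I_n) : {fraction lser} := tf (x a) / tf (2 + lbeta * x a).

Lemma schur_varD (a b : 'I_n) : schur_var a + schur_var b =
  tf 2 * tf (opl (x a) (x b)) / (tf (2 + lbeta * x a) * tf (2 + lbeta * x b)).
Proof.
have ha := two_beta_neq0 (geo_x K a); have hb := two_beta_neq0 (geo_x K b).
rewrite /schur_var addf_div ?tofrac_eq0 //; congr (_ / _).
by rewrite -!rmorphM -rmorphD /opl; congr tf; ring.
Qed.

Lemma schur_varB (a b : 'I_n) : schur_var b - schur_var a =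
  tf 2 * tf (x b - x a) / (tf (2 + lbeta * x b) * tf (2 + lbeta * x a)).
Proof.
have ha := two_beta_neq0 (geo_x K a); have hb := two_beta_neq0 (geo_x K b).
rewrite /schur_var -mulNr addf_div ?tofrac_eq0 //; congr (_ / _).
by rewrite -!rmorphM -rmorphN -!rmorphM -rmorphD; congr tf; ring.
Qed.

Lemma schur_varD_neq0 a b : schur_var a + schur_var b != 0.
Proof.
by rewrite schur_varD !mulf_neq0 ?invr_eq0 ?mulf_neq0 ?tofrac_eq0
  ?two_neq0 ?two_beta_neq0 ?opl_neq0.
Qed.

Lemma tofrac_Sx (a b : 'I_n) : tf (Sx K a b) = schur_ratio (schur_var a) (schur_var b).
Proof.
have [->|nab] := eqVneq a b; first by rewrite /Sx subrr mul0r rmorph0 schur_ratioxx.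
have U : opl (x a) (x b) \is a GRing.unit.
  by apply: opl_unit_neq => //; rewrite (inj_eq (@vx_inj n K)).
rewrite /schur_ratio schur_varB schur_varD /Sx rmorphM rmorphV //= (oplC (x b)).
have ha := two_beta_neq0 (geo_x K a); have hb := two_beta_neq0 (geo_x K b).
have ho := opl_neq0 (geo_x K a) (geo_x K b).
apply: divf_div_mul; rewrite ?mulf_neq0 ?tofrac_eq0 //; exact: two_neq0.
Qed.

Lemma pfaff_Sx m (g : nat -> 'I_n) : pfaff m (fun i j => Sx K (g i) (g j)) =
  \prod_(i < m.*2) \prod_(j < m.*2 | (i < j)%N) Sx K (g i) (g j).
Proof.
apply/eqP; rewrite -tofrac_eq rmorph_pfaff rmorph_prod; apply/eqP.
rewrite (eq_pfaff (B := fun i j => schur_ratio (schur_var (g i)) (schur_var (g j)))).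
  rewrite (schur_pfaffian _ (y := fun i => schur_var (g i))); last first.
    by move=> i j; apply: schur_varD_neq0.
  apply: eq_bigr => i _; rewrite rmorph_prod; apply: eq_bigr => j _.
  exact/esym/tofrac_Sx.
by move=> i j _ _; apply: tofrac_Sx.
Qed.

Definition lGQnum (nu : seq nat) (s : 'S_n) : lser :=
  \prod_(i < n | (i < size nu)%N)
    ((opl (x (s i)) (x (s i)) * \prod_(1 <= k < nth 0%N nu i) opl (x (s i)) (lb n K k)) *
     \prod_(j < n | (i < j)%N) opl (x (s i)) (x (s j))).

Definition lGQden (nu : seq nat) (s : 'S_n) : lser :=
  \prod_(i < n | (i < size nu)%N) \prod_(j < n | (i < j)%N) omn (x (s i)) (x (s j)).

Lemma lval_GQnum nu s : lval (lGQnum nu s) = @GQnum n K nu s.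
Proof.
rewrite /lGQnum lval_prod; apply: eq_bigr => i _.
by rewrite !lvalM !lval_prod.
Qed.

Lemma lval_GQden nu s : lval (lGQden nu s) = @GQden n K nu s.
Proof.
rewrite /lGQden lval_prod; apply: eq_bigr => i _; rewrite lval_prod.
by apply: eq_bigr => j _; rewrite lval_omn //; apply: small_beta.
Qed.

Lemma omn_unit (a b : 'I_n) : a != b -> omn (x a) (x b) \is a GRing.unit.
Proof.
move=> nab; have hb := small_beta (geo_x K b).
have nvab : vx a != vx b by rewrite (inj_eq (@vx_inj n K)).
have [U _] := inv_sub_neq (geo_x K a) (geo_x K b) nvab.
by rewrite omnE // unitrM U unitrV small_unit.
Qed.

Lemma lGQden_unit nu s : lGQden nu s \is a GRing.unit.
Proof.
apply: rpred_prod => i _; apply: rpred_prod => j ij; apply: omn_unit.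
by rewrite (inj_eq perm_inj); apply: contraTneq ij => ->; rewrite ltnn.
Qed.

(** Every [lGQden nu s] is a unit of the domain, so the formula with denominators cleared follows
    from one between sums of genuine fractions. *)
Lemma GQ_isP nu (P : lser) :
  P = \sum_(s : 'S_n | coset_rep (size nu) s) lGQnum nu s / lGQden nu s ->
  GQ_is nu (lval P).
Proof.
move=> PE; rewrite /GQ_is.
pose D (Q : pred 'S_n) := \prod_(s : 'S_n | coset_rep (size nu) s && Q s) lGQden nu s.
have DE Q : lval (D Q) =
    \big[@smul n K/@sc n K 1]_(s : 'S_n | coset_rep (size nu) s && Q s) @GQden n K nu s.
  by rewrite lval_prod; apply: eq_bigr => s _; apply: lval_GQden.
have -> : \big[@smul n K/@sc n K 1]_(s : 'S_n | coset_rep (size nu) s) @GQden n K nu s =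
    lval (D xpredT).
  by rewrite DE; apply: eq_bigl => s; rewrite andbT.
transitivity (lval (\sum_(s : 'S_n | coset_rep (size nu) s)
    lGQnum nu s * D (fun s' => s' != s))).
  rewrite -lvalM; congr lval; rewrite PE mulr_suml; apply: eq_bigr => s hs.
  rewrite /D (bigD1 s) /=; last by rewrite hs.
  rewrite -mulrA; congr (_ * _); rewrite mulKr ?lGQden_unit //.
  by apply: eq_bigl => s'; rewrite andbT.
rewrite (big_morph _ (@lvalD n K) (erefl : lval 0 = @sc n K 0)).
by apply: eq_bigr => s _; rewrite lvalM lval_GQnum DE.
Qed.

End SchurPfaffian.

(** * Matching injective maps with the summands of GQ *)

Section CosetSum.
Variables n K : nat.
Local Notation lser := (lser n K).
Local Notation lvar := (@lvar n K).
Local Notation lbeta := (@lbeta n K).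
Local Notation vx := (@vx n K).
Local Notation x j := (lvar (vx j)).
Local Notation Tx := (@Tx n K).
Local Notation Sx := (@Sx n K).
Hint Resolve geo_u1 geo_u2 geo_x : core.

Lemma x_neq (a b : 'I_n) : a != b -> vx a != vx b.
Proof. by rewrite (inj_eq (@vx_inj n K)). Qed.

(** Off the diagonal the factors combine to (x_a (+) x_j)/(x_a (-) x_j). On it, x_a (+) x_a is the
    leading factor of GQ, and 1 + beta x_a cancels one of the [d.+1] powers in [num]. *)
Lemma Tx_perm d p (s : 'S_n) i : Tx d p (s i) =
  (opl (x (s i)) (x (s i)) * \prod_(1 <= k < p) opl (x (s i)) (lb n K k)) *
  ((1 + lbeta * x (s i))^-1 ^+ d *
   \prod_(j | j != i) (opl (x (s i)) (x (s j)) / omn (x (s i)) (x (s j)))).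
Proof.
rewrite /Tx /num.
rewrite [\prod_j opl _ _](reindex_inj (@perm_inj _ s)) (bigD1 i) //=.
rewrite [\prod_j (1 + _)](reindex_inj (@perm_inj _ s)) [\prod_j (1 + _)](bigD1 i) //=.
rewrite [\prod_(j | j != s i) _](reindex_inj (@perm_inj _ s)) /=.
rewrite [\prod_(j | s j != s i) _](eq_bigl (fun j => j != i)); last first.
  by move=> j; rewrite (inj_eq perm_inj).
have -> : \prod_(j | j != i) (opl (x (s i)) (x (s j)) / omn (x (s i)) (x (s j))) =
  \prod_(j | j != i) opl (x (s i)) (x (s j)) * \prod_(j | j != i) (1 + lbeta * x (s j)) *
  \prod_(j | j != i) (x (s i) - x (s j))^-1.
  rewrite -!big_split; apply: eq_bigr => j nji /=; rewrite -mulrA; congr (_ * _).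
  have hb := small_beta (geo_x K (s j)); have U := small_unit hb.
  have nij : vx (s i) != vx (s j) by rewrite x_neq // (inj_eq perm_inj) eq_sym.
  have [U' _] := inv_sub_neq (geo_x K (s i)) (geo_x K (s j)) nij.
  by rewrite omnE // invrM ?unitrV // invrK.
have U := small_unit (small_beta (geo_x K (s i))).
have e := mulVr U; rewrite exprS.
set g := (1 + _)^-1 in e *; set h := 1 + lbeta * x (s i) in e *.
set A := \prod_(1 <= k < _) _; set B := \prod_(j | _) opl _ _.
set C := \prod_(j | _) (1 + _); set D := \prod_(j | _) _^-1; set O := opl _ _.
by transitivity (O * A * (g ^+ d * (B * C * D)) * (g * h)); [ring | rewrite e mulr1].
Qed.

Lemma coset_term r (rn : (r <= n)%N) nu (s : 'S_n) : size nu = r ->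
  \prod_(k < r) Tx (r - k.+1) (nth 0%N nu k) (s (widen_ord rn k)) *
  \prod_(i < r) \prod_(j < r | (i < j)%N) Sx (s (widen_ord rn i)) (s (widen_ord rn j)) =
  lGQnum K nu s / lGQden K nu s.
Proof.
move=> snu; pose E (i j : 'I_n) := opl (x (s i)) (x (s j)) / omn (x (s i)) (x (s j)).
pose S (i j : 'I_n) := Sx (s i) (s j).
pose g (i : 'I_n) := (1 + lbeta * x (s i))^-1.
pose c (i : 'I_n) := opl (x (s i)) (x (s i)) *
  \prod_(1 <= k < nth 0%N nu i) opl (x (s i)) (lb n K k).
(* The product of [E j i] and [S i j] is 1 + beta x_(s i). For fixed i there are r - i - 1 indices j
   with i < j < r, which is exactly the exponent carried by [Tx]. *)
have ESg (i j : 'I_n) : (i < j)%N -> E j i * S i j * g i = 1.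
  move=> ij; have nij : s j != s i.
    by rewrite (inj_eq perm_inj) eq_sym; apply: contraTneq ij => ->; rewrite ltnn.
  have nv := x_neq nij.
  have hb := small_beta (geo_x K (s i)); have U := small_unit hb.
  have [U' _] := inv_sub_neq (geo_x K (s j)) (geo_x K (s i)) nv.
  have O := opl_unit_neq (geo_x K (s j)) (geo_x K (s i)) nv.
  rewrite /E /S /Sx /g omnE // (oplC (x (s i))) invrM ?unitrV // invrK.
  move: (mulVr U) (mulrV U') (mulrV O); set o := opl _ _; set h := 1 + _; set d := _ - _.
  move=> e1 e2 e3.
  by transitivity ((h^-1 * h) * (d * d^-1) * (o * o^-1)); [ring | rewrite e1 e2 e3 !mulr1].
have -> : \prod_(k < r) Tx (r - k.+1) (nth 0%N nu k) (s (widen_ord rn k)) =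
  \prod_(i < n | (i < r)%N) (c i * (g i ^+ (r - i.+1) * \prod_(j < n | j != i) E i j)).
  by rewrite (big_ord_narrow rn); apply: eq_bigr => i _; rewrite Tx_perm.
have -> : \prod_(i < r) \prod_(j < r | (i < j)%N) Sx (s (widen_ord rn i)) (s (widen_ord rn j)) =
  \prod_(i < n | (i < r)%N) \prod_(j < n | (i < j)%N && (j < r)%N) S i j.
  rewrite (big_ord_narrow rn); apply: eq_bigr => i _.
  by rewrite (big_ord_narrow_cond (P := fun j : 'I_n => (widen_ord rn i < j)%N) rn).
rewrite big_split -mulrA prod_cancel_pairs //.
have EU i j : E i j = opl (x (s i)) (x (s j)) / omn (x (s i)) (x (s j)) by [].
rewrite /lGQnum snu [X in _ = X / _]big_split -[RHS]mulrA; congr (_ * _).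
apply: (mulIr (lGQden_unit K nu s)); rewrite divrK ?lGQden_unit // /lGQden snu.
rewrite -big_split; apply: eq_bigr => i _ /=; rewrite -big_split; apply: eq_bigr => j ij /=.
rewrite /E divrK // omn_unit // (inj_eq perm_inj).
by apply: contraTneq ij => ->; rewrite ltnn.
Qed.

Lemma pfaff_sum_coset_rep m nu : size nu = m.*2 -> (m.*2 <= n)%N ->
  pfaff m (fun i j => \sum_a \sum_b Tx (m.*2 - i.+1) (nth 0%N nu i) a *
     Tx (m.*2 - j.+1) (nth 0%N nu j) b * Sx a b) =
  \sum_(s : 'S_n | coset_rep (size nu) s) lGQnum K nu s / lGQden K nu s.
Proof.
move=> snu mn; rewrite snu.
(* For m = 0 the set ['I_n] may be empty and offer no default for [ext]. Both sides are then 1, the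
   identity being the only increasing permutation. *)
case: (posnP m.*2) => [m0|m_gt0].
  have e0 : m = 0%N by lia.
  move: snu; rewrite {}e0 {m m0 mn} => snu.
  rewrite pfaff0 (big_pred1 1%g) => [|s].
    by rewrite /lGQnum /lGQden snu !big_pred0 // divr1.
  apply/idP/eqP => [hs|->]; last by apply/coset_repP => i j; rewrite !perm1.
  by apply: (coset_rep_inj hs) => //; apply/coset_repP => i j; rewrite !perm1.
have a0 : 'I_n := Ordinal (leq_trans m_gt0 mn).
rewrite (pfaff_congruence m a0 (fun i a => Tx (m.*2 - i.+1) (nth 0%N nu i) a) Sx).
under eq_bigr => f _ do rewrite (pfaff_Sx K m (ext a0 f)).
pose G (f : {ffun 'I_(m.*2) -> 'I_n}) :=
  \prod_(k < m.*2) Tx (m.*2 - k.+1) (nth 0%N nu k) (f k) *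
  \prod_(i < m.*2) \prod_(j < m.*2 | (i < j)%N) Sx (f i) (f j).
rewrite (eq_bigr G); last first.
  move=> f _; congr (_ * _); apply: eq_bigr => i _; apply: eq_bigr => j _.
  by rewrite !extE.
rewrite (bigID (fun f : {ffun 'I_(m.*2) -> 'I_n} => injectiveb f)) /= addrC big1 ?add0r.
  rewrite (sum_coset_rep mn); apply: eq_bigr => s _.
  rewrite -(coset_term mn s snu) /G; congr (_ * _); first by apply: eq_bigr => i _; rewrite ffunE.
  by apply: eq_bigr => i _; apply: eq_bigr => j _; rewrite !ffunE.
move=> f /injectivePn[i [j nij fij]].
suff S0 (k l : 'I_m.*2) : (k < l)%N -> f k = f l -> G f = 0.
  case: (ltngtP i j) => [ij|ji|/val_inj e]; first exact: S0 ij fij.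
    exact: S0 ji (esym fij).
  by rewrite e eqxx in nij.
move=> kl e; rewrite /G [X in _ * X](bigD1 k) //= [X in _ * (X * _)](bigD1 l) //=.
by rewrite e /Sx subrr !mul0r mulr0.
Qed.

Lemma lval_sign (b : bool) : lval ((-1) ^+ b) = @sc n K ((-1) ^+ b).
Proof.
case: b; last by rewrite lval1.
rewrite !expr1 lvalN lval1; apply/funext => e.
by rewrite /sopp /sc; case: ifP; rewrite ?oppr0.
Qed.

Lemma lval_pfaff m (A : nat -> nat -> ser n K) (B : nat -> nat -> lser) :
  (forall i j, (i < j)%N -> (j < m.*2)%N -> A i.+1 j.+1 = lval (B i j)) ->
  Pf m A = lval (pfaff m B).
Proof.
move=> AB; rewrite /Pf /pfaff (big_morph _ (@lvalD n K) (erefl : lval 0 = @sc n K 0)).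
apply: eq_bigr => s /pf_permP[h1 _]; rewrite lvalM lval_sign lval_prod.
congr smul; apply: eq_bigr => i _; apply: AB; first exact: h1.
have hi : (i.*2.+1 < m.*2)%N by rewrite ltn_Sdouble.
by rewrite (svE s (Ordinal hi)).
Qed.

End CosetSum.

(** With 0-based i < j < 2m both upper arguments of [binz] are nonpositive, so the truncated
    subtractions are exact, and [binser] applies. *)
Lemma pf_family_entry n K m nu i j : (i < j)%N -> (j < m.*2)%N ->
  (0 < nth 0 nu i)%N -> (0 < nth 0 nu j)%N ->
  @pf_family n K m nu i.+1 j.+1 =
  @entry_family n K (m.*2 - i.+2) (m.*2 - j.+1) (nth 0%N nu i).-1 (nth 0%N nu j).-1.
Proof.
move=> ij jm pi pj; apply/funext => kl; rewrite /pf_family /entry_family !prednK //=.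
have -> : (i.+1)%:Z + 1 - (m.*2)%:Z = - (m.*2 - i.+2)%:Z by lia.
by have -> : (j.+1)%:Z - (m.*2)%:Z = - (m.*2 - j.+1)%:Z by lia.
Qed.

Theorem mainTheorem18 (n K m : nat) (nu : seq nat) :
  size nu = m.*2 -> (m.*2 <= n)%N -> sorted gtn nu -> all (fun p => 0 < p)%N nu ->
  (head 0%N nu <= K)%N ->
  (forall i j : nat, (1 <= i)%N -> (i < j)%N -> (j <= m.*2)%N ->
     summable (@pf_family n K m nu i j)) /\
  GQ_is nu (Pf m (@pf_entry n K m nu)).
Proof.
move=> snu mn nu_sorted /all_nthP nu_pos nuK.
have pos i : (i < m.*2)%N -> (0 < nth 0%N nu i)%N by rewrite -snu; apply: nu_pos.
have leK i : (i < m.*2)%N -> ((nth 0%N nu i).-1 <= K)%N.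
  move=> im; apply: leq_trans (leq_pred _) (leq_trans _ nuK).
  have tgt : transitive gtn by move=> a b c ab bc; apply: ltn_trans bc ab.
  rewrite -nth0; case: i im => [|i] im //.
  by apply/ltnW/(sorted_ltn_nth tgt) => //; rewrite inE snu // (leq_trans _ im).
split=> [[|i] [|j] // _ ij jm|].
  by rewrite pf_family_entry ?pos //; [apply: entry_family_summable | apply: ltn_trans jm].
pose B i j := lA n K (m.*2 - i.+2) (m.*2 - j.+1) (nth 0%N nu i).-1 (nth 0%N nu j).-1.
rewrite (@lval_pfaff _ _ _ _ B) => [|i j ij jm]; last first.
  have im := ltn_trans ij jm.
  by rewrite /pf_entry pf_family_entry ?pos // fsum_entry_family.
apply: GQ_isP; rewrite -(pfaff_sum_coset_rep K snu mn).
apply: eq_pfaff => i j ij jm; have im := ltn_trans ij jm.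
rewrite /B lA_eq ?leK ?prednK ?pos //; last by apply: leq_trans mn; apply: leq_ltn_trans jm.
(* The power of 1/(1 + beta u1) coming from the kernel equalizes the row exponent with the column
   exponent of the same index. *)
by have -> : (m.*2 - i.+2).+1 = (m.*2 - i.+1)%N by lia.
Qed.
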